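(* Let $t\ge1$ and $p\ge1$ be integers and let $K=T_{(2,2t+1)}$ be the torus knot. Then the ADO invariant of $K$ is $$\mathrm{ADO}_K(x,e_p)=e_p^{\,t}\,x^{t(1-p)}\sum_{p-1\ge k_t\ge\dots\ge k_1\ge0}(x\,e_p;e_p)_{k_t}\,x^{k_t}\prod_{i=1}^{t-1}e_p^{\,k_i(k_i+1)}\,x^{2k_i}\begin{bmatrix}k_{i+1}\\k_i\end{bmatrix}_{e_p}.$$
   Context: Roots of unity: $e_p=\exp(2\pi i/p)$, $e_{2p}=\exp(\pi i/p)$, and for $z\in\mathbb C$, $e_p^z=\exp(2\pi i z/p)$, $e_{2p}^z=\exp(\pi i z/p)$. Notation: $(a;q)_n=(1-a)(1-aq)\cdots(1-aq^{n-1})$; $[n]_q=\frac{1-q^n}{1-q}$, $[n]_q!=[n]_q\cdots[1]_q$, and $\begin{bmatrix}n\\k\end{bmatrix}_q=\frac{[n]_q!}{[k]_q![n-k]_q!}$ is the $q$-binomial, a polynomial in $q$ which is evaluated at $q=e_p$. Knot conventions: $T_{(2,2t+1)}$ is the $0$-framed right-handed (positive) $(2,2t+1)$ torus knot; in the conventions used here the colored Jones polynomial of $T_{(2,3)}$ for the $2$-dimensional representation (normalized to $1$ on the unknot) is $q^{-1}+q^{-3}-q^{-4}$, where the colored Jones polynomial is computed with the same crossing conventions as the ADO invariant below but with generic $v=q^{1/2}$. ADO invariant: let $p\ge2$, $v=e_{2p}$, $\{y\}=v^y-v^{-y}$, $\{n\}!=\{n\}\cdots\{1\}$. The unrolled quantum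 $\mathfrak{sl}_2$ is the $\mathbb C$-algebra generated by $E,F,K^{\pm1},H$ with $HK=KH$, $[H,E]=2E$, $[H,F]=-2F$, $KE=v^2EK$, $KF=v^{-2}FK$, $[E,F]=(K-K^{-1})/(v-v^{-1})$, $E^p=F^p=0$, and coproduct $E\mapsto 1\otimes E+E\otimes K$, $F\mapsto K^{-1}\otimes F+F\otimes1$, $K\mapsto K\otimes K$, $H\mapsto H\otimes1+1\otimes H$. Its finite-dimensional weight modules ($H$ diagonalizable, $K=v^H$) form a ribbon category with braiding (positive crossing) given by the flip composed with $R=v^{H\otimes H/2}\sum_{n=0}^{p-1}\frac{\{1\}^{2n}}{\{n\}!}v^{n(n-1)/2}E^n\otimes F^n$ and pivotal element $K^{1-p}$. For (generic) $\lambda\in\mathbb C$, $V_\lambda$ is the $p$-dimensional irreducible projective module of highest weight $\lambda$. If $T$ is a $0$-framed $(1,1)$-tangle with closure the knot $K$, coloring $T$ by $V_\lambda$ and applying the Reshetikhin–Turaev functor gives the endomorphism $\mathrm{ADO}_K(e_p^{\lambda+1},e_p)\,\mathrm{id}_{V_\lambda}$; this defines the Laurent polynomial $\mathrm{ADO}_K(x,e_p)$ in $x$, which is $1$ for the unknot. For $p=1$, $\mathrm{ADO}_K(x,1)=1$. *)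

(* Defs.v *)
From HB Require Import structures.
From mathcomp Require Import all_boot all_order all_algebra.
From mathcomp Require Import ring.
From mathcomp Require Import all_classical all_reals all_analysis.
From mathcomp Require Import complex mxtens.

Set Implicit Arguments.
Unset Strict Implicit.
Unset Printing Implicit Defensive.

Import Order.TTheory GRing.Theory Num.Theory.
Local Open Scope ring_scope.
Local Open Scope complex_scope.

Section Exponentials.
Variable R : realType.
Implicit Types (p : nat) (y z : R[i]).

Definition Cexp z : R[i] :=
  (expR (complex.Re z) * cos (complex.Im z))
  +i* (expR (complex.Re z) * sin (complex.Im z)).

(* e_p^z, and v^z for v = e_{2p} *)
Definition epow p z : R[i] := Cexp (2%:R * pi%:C * 'i * z / p%:R).
Definition vpow p z : R[i] := Cexp (pi%:C * 'i * z / p%:R).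

(* {y} and {n}! *)
Definition brace p y : R[i] := vpow p y - vpow p (- y).
Definition brace_fact p n : R[i] := \prod_(1 <= i < n.+1) brace p i%:R.

Lemma CexpD y z : Cexp (y + z) = Cexp y * Cexp z.
Proof.
case: y => a b; case: z => c d; rewrite /Cexp; simpc => /=.
by rewrite expRD cosD sinD; congr (_ +i* _); ring.
Qed.

Lemma Cexp0 : Cexp 0 = 1.
Proof. by rewrite /Cexp /= expR0 cos0 sin0 mulr1 mulr0. Qed.

Lemma vpowD p y z : vpow p (y + z) = vpow p y * vpow p z.
Proof. by rewrite /vpow -CexpD; congr Cexp; ring. Qed.

Lemma vpow0 p : vpow p 0 = 1.
Proof. by rewrite /vpow mulr0 mul0r Cexp0. Qed.

Lemma vpow_neq0 p z : vpow p z != 0.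
Proof.
apply/eqP => z0; have := vpowD p z (- z).
by rewrite subrr vpow0 z0 mul0r => /eqP; rewrite oner_eq0.
Qed.

Lemma vpowN p z : vpow p (- z) = (vpow p z)^-1.
Proof.
apply: (mulfI (vpow_neq0 p z)).
by rewrite -vpowD subrr vpow0 divff ?vpow_neq0.
Qed.

Lemma brace0 p : brace p 0 = 0.
Proof. by rewrite /brace oppr0 subrr. Qed.

Lemma bracep p : (0 < p)%N -> brace p p%:R = 0.
Proof.
move=> p0; have pn0 : p%:R != 0 :> R[i] by rewrite pnatr_eq0 -lt0n.
have Ci : pi%:C * 'i = 0 +i* pi :> R[i] by simpc.
rewrite /brace /vpow mulrN mulNr mulfK // Ci /Cexp /= oppr0.
by rewrite cosN sinN sinpi oppr0 subrr.
Qed.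

End Exponentials.

(* Matrices act on column vectors: A i j is the coefficient of v_i in A v_j,
   so the product A *m B means "B first, then A". *)

(* H is diagonal in the chosen basis, with eigenvalues w, and K = v^H. *)
Definition weight_module (R : realType) (p n : nat) (w : 'I_n -> R[i])
    (E F : 'M[R[i]]_n) : Prop :=
  let H := diag_mx (\row_i w i) in
  let K := diag_mx (\row_i vpow p (w i)) in
  let Kinv := diag_mx (\row_i (vpow p (w i))^-1) in
  [/\ H *m E - E *m H = 2%:R *: E /\ H *m F - F *m H = - 2%:R *: F,
      K *m E = vpow p 2%:R *: (E *m K) /\ K *m F = vpow p (- 2%:R) *: (F *m K),
      E *m F - F *m E = (vpow p 1 - vpow p (- 1))^-1 *: (K - Kinv),
      E ^+ p = 0 & F ^+ p = 0].

(* V_lambda: basis v_0, ..., v_{p-1} with v_0 of highest weight lambda,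
   F v_j = v_{j+1} and E v_j = [j] [lambda + 1 - j] v_{j-1}. *)
Section HighestWeightModule.
Variables (R : realType) (p : nat) (lam : R[i]).

Definition wt (i : 'I_p) : R[i] := lam - 2%:R * (i : nat)%:R.

Definition Emx : 'M[R[i]]_p := \matrix_(i, j)
  if i.+1 == j
  then brace p (j : nat)%:R / brace p 1 * (brace p (lam + 1 - (j : nat)%:R) / brace p 1)
  else 0.

Definition Fmx : 'M[R[i]]_p := \matrix_(i, j) (i == j.+1 :> nat)%:R.

(* v^{H (x) H / 2} *)
Definition vHH : 'M[R[i]]_(p * p) :=
  diag_mx (\row_k let ij := mxtens_unindex k in
                  vpow p (wt ij.1 * wt ij.2 / 2%:R)).

Definition Rmx : 'M[R[i]]_(p * p) :=
  vHH *m \sum_(n < p) (brace p 1 ^+ (2 * n) / brace_fact R p n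
                       * vpow p (n%:R * (n%:R - 1) / 2%:R))
                      *: (Emx ^+ n *t Fmx ^+ n).

Definition flip : 'M[R[i]]_(p * p) := \matrix_(k, l)
  let a := mxtens_unindex k in let b := mxtens_unindex l in
  ((a.1 == b.2) && (a.2 == b.1))%:R.

Definition braiding : 'M[R[i]]_(p * p) := flip *m Rmx.

(* eigenvalue of the pivotal element K^{1-p} on v_i *)
Definition pivot (i : 'I_p) : R[i] := vpow p (wt i) ^ (1 - p%:Z).

Let cE (j : nat) : R[i] :=
  brace p j%:R / brace p 1 * (brace p (lam + 1 - j%:R) / brace p 1).

Lemma EmxE (i j : 'I_p) : Emx i j = cE j *+ (i.+1 == j).
Proof. by rewrite mxE; case: ifP. Qed.

Lemma FmxE (i j : 'I_p) : Fmx i j = (i == j.+1 :> nat)%:R.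
Proof. by rewrite mxE. Qed.

Lemma Emx_exp0 n (i j : 'I_p) : (i + n != j)%N -> (Emx ^+ n) i j = 0.
Proof.
elim: n i j => [|n IH] i j; first by rewrite addn0 expr0 mxE -val_eqE => /negPf ->.
move=> ne; rewrite exprS mxE big1 // => k _; rewrite EmxE.
case: eqP => [ik|_]; last by rewrite mulr0n mul0r.
by rewrite IH ?mulr0 // -ik addSnnS.
Qed.

Lemma Fmx_exp0 n (i j : 'I_p) : (i != j + n :> nat)%N -> (Fmx ^+ n) i j = 0.
Proof.
elim: n i j => [|n IH] i j; first by rewrite addn0 expr0 mxE -val_eqE => /negPf ->.
move=> ne; rewrite exprS mxE big1 // => k _; rewrite FmxE.
case: eqP => [ik|_]; last by rewrite mul0r.
by rewrite IH ?mulr0 // -eqSS -ik -addnS.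
Qed.

Lemma Emx_nilp : Emx ^+ p = 0.
Proof.
apply/matrixP => i j; rewrite Emx_exp0 ?mxE // neq_ltn orbC.
by rewrite (leq_trans (ltn_ord j)) ?leq_addl.
Qed.

Lemma Fmx_nilp : Fmx ^+ p = 0.
Proof.
apply/matrixP => i j; rewrite Fmx_exp0 ?mxE // neq_ltn.
by rewrite (leq_trans (ltn_ord i)) ?leq_addl.
Qed.

Lemma cE_step (i : nat) :
  cE i.+1 - cE i = (vpow p 1 - vpow p (- 1))^-1 *
    (vpow p (lam - 2%:R * i%:R) - (vpow p (lam - 2%:R * i%:R))^-1).
Proof.
rewrite -[X in X^-1 * _]/(brace p 1) /cE.
have [->|b1] := eqVneq (brace p (1 : R[i])) 0; first by rewrite !invr0; ring.
have -> : lam + 1 - i.+1%:R = lam - i%:R :> R[i] by rewrite -natr1; ring.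
have -> : lam - 2%:R * i%:R = lam - i%:R - i%:R :> R[i] by ring.
move: b1; rewrite -natr1 /brace !(vpowD, vpowN, opprD, opprK).
have := vpow_neq0 p lam; have := vpow_neq0 p (i%:R : R[i]).
have := vpow_neq0 p (1 : R[i]).
move: (vpow p lam) (vpow p i%:R) (vpow p 1) => a b c c0 b0 a0 d.
have d' : c * c - 1 != 0.
  by apply: contra d => /eqP d; apply/eqP/(mulfI c0); rewrite mulrBr divff ?mulr0.
by field; rewrite c0 b0 a0.
Qed.

Lemma weight_module_V : (0 < p)%N -> weight_module p wt Emx Fmx.
Proof.
move=> p0; split; [split|split| | |].
- apply/matrixP => i j; rewrite mul_diag_mx mul_mx_diag !mxE.
  case: eqP => [ij|_] /=; rewrite ?mulr1n ?mulr0n; last by ring.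
  by rewrite /wt -ij -natr1; ring.
- apply/matrixP => i j; rewrite mul_diag_mx mul_mx_diag !mxE.
  case: eqP => [ij|_] /=; rewrite ?mulr1n ?mulr0n; last by ring.
  by rewrite /wt ij -natr1; ring.
- apply/matrixP => i j; rewrite mul_diag_mx mul_mx_diag !mxE.
  case: eqP => [ij|_] /=; rewrite ?mulr1n ?mulr0n; last by ring.
  have -> : wt i = wt j + 2%:R by rewrite /wt -ij -natr1; ring.
  by rewrite vpowD; ring.
- apply/matrixP => i j; rewrite mul_diag_mx mul_mx_diag !mxE.
  case: eqP => [ij|_] /=; rewrite ?mulr1n ?mulr0n; last by ring.
  have -> : wt i = wt j + - 2%:R by rewrite /wt ij -natr1; ring.
  by rewrite vpowD; ring.
- have EF i j : (Emx *m Fmx) i j = cE i.+1 *+ (i == j).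
    rewrite mxE; have [ip|ip] := ltnP i.+1 p.
      rewrite (bigD1 (Ordinal ip)) //= big1 ?addr0; last first.
        move=> k kne; rewrite EmxE; case: (i.+1 =P k) => [ik|_].
          by case/eqP: kne; apply: val_inj.
        by rewrite mulr0n mul0r.
      by rewrite EmxE FmxE eqxx mulr1n eqSS val_eqE mulr_natr.
    have ->: i.+1 = p by apply/eqP; rewrite eqn_leq ltn_ord.
    rewrite /cE bracep // !mul0r mul0rn big1 // => k _.
    rewrite EmxE; case: eqP => [ik|_]; last by rewrite mulr0n mul0r.
    by have := ltn_ord k; rewrite -ik ltnNge ip.
  have FE i j : (Fmx *m Emx) i j = cE i *+ (i == j).
    rewrite mxE; case: i => -[|m] hm.
      rewrite /cE brace0 !mul0r mul0rn big1 // => k _.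
      by rewrite FmxE mul0r.
    rewrite (bigD1 (Ordinal (ltnW hm))) //= big1 ?addr0; last first.
      move=> k kne; rewrite FmxE /=; case: (m.+1 =P k.+1) => [[ik]|_].
        by case/eqP: kne; apply: val_inj.
      by rewrite mul0r.
    rewrite EmxE FmxE eqxx mul1r -val_eqE /=.
    by case: eqP => [->|].
  apply/matrixP => i j; move: (EF i j) (FE i j).
  rewrite !mxE => -> ->; rewrite -mulrnBl cE_step /wt.
  by rewrite -mulrnAr mulrnBl.
- exact: Emx_nilp.
- exact: Fmx_nilp.
Qed.

Lemma flipK : flip *m flip = 1%:M.
Proof.
apply/matrixP => k l; case: (mxtens_indexP k) => a b.
case: (mxtens_indexP l) => c d; rewrite mxE.
rewrite (bigD1 (mxtens_index (b, a))) //= !mxE !mxtens_indexK /= !eqxx mul1r.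
rewrite big1 ?addr0; last first.
  move=> m; case: (mxtens_indexP m) => e f ne; rewrite !mxE !mxtens_indexK /=.
  case: eqP => [ea|]; last by rewrite mul0r.
  case: eqP => [eb|]; last by rewrite mul0r.
  by rewrite ea eb eqxx in ne.
by rewrite (can_eq (@mxtens_indexK p p)) xpair_eqE andbC.
Qed.

Lemma tens_exp n : Emx ^+ n *t Fmx ^+ n = (Emx *t Fmx) ^+ n.
Proof.
elim: n => [|n IH]; last by rewrite !exprS -IH -!mulmxE tensmx_mul.
apply/matrixP => k l; case: (mxtens_indexP k) => a b.
case: (mxtens_indexP l) => c d; rewrite !expr0 tensmxE !mxE.
by rewrite (can_eq (@mxtens_indexK p p)) xpair_eqE -natrM mulnb.
Qed.

Lemma braiding_unit : (0 < p)%N -> braiding \in unitmx.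
Proof.
move=> p0; rewrite /braiding /Rmx !unitmx_mul; apply/and3P; split.
- by case: (mulmx1_unit flipK).
- rewrite unitmxE det_diag unitfE; apply/prodf_neq0 => k _.
  by rewrite !mxE vpow_neq0.
set c := fun n : nat => brace p 1 ^+ (2 * n) / brace_fact R p n
  * vpow p (n%:R * (n%:R - 1) / 2%:R).
set X := Emx *t Fmx; pose Y := \sum_(1 <= n < p) c n *: X ^+ n.-1.
have -> : \sum_(n < p) c n *: (Emx ^+ n *t Fmx ^+ n) = 1 - - (X * Y).
  under eq_bigr => n _ do rewrite tens_exp.
  rewrite opprK -(big_mkord xpredT (fun n => c n *: X ^+ n)) big_ltn //.
  rewrite {1}/c /brace_fact big_nil !mul0r vpow0 expr0 invr1 !mulr1 scale1r.
  congr (_ + _); rewrite /Y mulr_sumr big_nat_cond [RHS]big_nat_cond.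
  by apply: eq_bigr => -[|n] // _; rewrite -mulmxE -scalemxAr mulmxE -exprS.
have Xp : (- (X * Y)) ^+ p = 0.
  have XY : GRing.comm X Y.
    apply: commr_sum => n _; rewrite /GRing.comm -mulmxE -scalemxAl -scalemxAr.
    by rewrite !mulmxE -exprSr exprS.
  by rewrite exprNn exprMn_comm // -tens_exp Emx_nilp tens0mx mul0r mulr0.
have := subrX1 (- (X * Y)) p; rewrite Xp sub0r => /(congr1 -%R).
rewrite opprK -mulNr opprB => /esym; rewrite -mulmxE => /mulmx1_unit.
by case.
Qed.
End HighestWeightModule.

(* Diagrams of oriented framed (blackboard framing) tangles, read from bottom
   to top: [tangle s t] has bottom boundary s and top boundary t.  Crossings
   between upward strands, together with the four cups and caps, generate;
   [tpos] is the positive (right-handed) crossing. *)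
Inductive orientation := Up | Down.

Inductive tangle : seq orientation -> seq orientation -> Type :=
| tid s : tangle s s
| tcomp s t u : tangle t u -> tangle s t -> tangle s u
| ttens s t s' t' : tangle s t -> tangle s' t' -> tangle (s ++ s') (t ++ t')
| tpos : tangle [:: Up; Up] [:: Up; Up]
| tneg : tangle [:: Up; Up] [:: Up; Up]
| tev : tangle [:: Down; Up] [::]
| tcoev : tangle [::] [:: Up; Down]
| tevr : tangle [:: Up; Down] [::]
| tcoevr : tangle [::] [:: Down; Up].

(* For a (1,1)-tangle without closed components the writhe is the framing. *)
Fixpoint writhe s t (T : tangle s t) : int :=
  match T with
  | tcomp _ _ _ T1 T2 => writhe T1 + writhe T2
  | ttens _ _ _ _ T1 T2 => writhe T1 + writhe T2
  | tpos => 1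
  | tneg => -1
  | _ => 0
  end.

(* Reshetikhin-Turaev functor with all strands coloured by V_lambda: Up stands
   for V_lambda, Down for its dual with the dual basis.  [RT lam T b a] is
   the coefficient of the basis tensor indexed by b in the image of the basis
   tensor indexed by a.  The maps attached to [tevr] and [tcoevr] are
   v (x) f |-> f (K^{1-p} v) and 1 |-> \sum_i v_i^* (x) K^{p-1} v_i. *)
Fixpoint RT (R : realType) (p : nat) (lam : R[i]) s t (T : tangle s t) :
    seq 'I_p -> seq 'I_p -> R[i] :=
  match T with
  | tid _ => fun b a => (b == a)%:R
  | tcomp _ m _ T1 T2 => fun b a =>
      \sum_(c : (size m).-tuple 'I_p) RT lam T1 b c * RT lam T2 c a
  | ttens s1 t1 _ _ T1 T2 => fun b a =>
      RT lam T1 (take (size t1) b) (take (size s1) a)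
      * RT lam T2 (drop (size t1) b) (drop (size s1) a)
  | tpos => fun b a =>
      if (b, a) is ([:: b1; b2], [:: a1; a2]) then
        braiding p lam (mxtens_index (b1, b2)) (mxtens_index (a1, a2))
      else 0
  | tneg => fun b a =>
      if (b, a) is ([:: b1; b2], [:: a1; a2]) then
        invmx (braiding p lam) (mxtens_index (b1, b2)) (mxtens_index (a1, a2))
      else 0
  | tev => fun b a =>
      if (b, a) is ([::], [:: a1; a2]) then (a1 == a2)%:R else 0
  | tcoev => fun b a =>
      if (b, a) is ([:: b1; b2], [::]) then (b1 == b2)%:R else 0
  | tevr => fun b a =>
      if (b, a) is ([::], [:: a1; a2]) then (a1 == a2)%:R * pivot lam a1
      else 0
  | tcoevr => fun b a =>
      if (b, a) is ([:: b1; b2], [::]) then (b1 == b2)%:R * (pivot lam b1)^-1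
      else 0
  end.

(* The parameters for which V_lambda is irreducible and projective. *)
Definition typical (R : realType) (p : nat) (lam : R[i]) : Prop :=
  (forall k : int, lam <> k%:~R) \/ (exists k : int, lam + 1 = (p%:Z * k)%:~R).

(* [is_ADO p T A]: A is the ADO invariant of the closure of the (1,1)-tangle T
   (supposed to have no closed component).  Laurent polynomials in x are the
   elements P / x^n of the field C(x). *)
Definition is_ADO (R : realType) (p : nat) (T : tangle [:: Up] [:: Up])
    (A : {fraction {poly R[i]}}) : Prop :=
  writhe T = 0 /\
  if p == 1%N then A = 1 else
  exists (P : {poly R[i]}) (n : nat),
    A = tofrac P / tofrac 'X^n /\
    forall lam : R[i], typical p lam ->
      let x := epow p (lam + 1) in
      \matrix_(i, j < p) RT lam T [:: i] [:: j] = (P.[x] / x ^+ n)%:M.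

Lemma is_ADO_unique (R : realType) (p : nat) (T : tangle [:: Up] [:: Up])
    (A B : {fraction {poly R[i]}}) :
  (0 < p)%N -> is_ADO p T A -> is_ADO p T B -> A = B.
Proof.
move=> p0 [_ HA] [_ HB]; move: HA HB; case: eqP => [_ -> -> //|_].
move=> [P [n [-> HP]]] [Q [m [-> HQ]]].
have X0 k : tofrac 'X^k != 0 :> {fraction {poly R[i]}}.
  by rewrite tofrac_eq0 expf_neq0 ?polyX_eq0.
apply/eqP; rewrite eqr_div //; apply/eqP; rewrite -!tofracM; congr tofrac.
apply/eqP; rewrite -subr_eq0; set D := _ - _; apply/negP => /negP D0.
pose la k : R[i] := 0 +i* k.+1%:R.
pose x k := epow p (la k + 1).
have pr0 : p%:R != 0 :> R by rewrite pnatr_eq0 -lt0n.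
pose r : R := expR (- (2%:R * pi / p%:R)).
have la_typ k : typical p (la k).
  left => z; rewrite -(rmorph_int (real_complex R)) => /(congr1 (@complex.Im R)) /=.
  by apply/eqP; rewrite pnatr_eq0.
have xE k : x k = epow p 1 * (r ^+ k.+1)%:C.
  have -> : (r ^+ k.+1)%:C = epow p (la k).
    rewrite /epow.
    have -> : 2%:R * pi%:C * 'i * la k / p%:R
              = (k.+1%:R * - (2%:R * pi / p%:R))%:C :> R[i].
      rewrite -(rmorph_nat (real_complex R) p) -(rmorph_nat (real_complex R) 2).
      rewrite -fmorphV /la; simpc => /=.
      by congr (_ +i* _); ring.
    by rewrite /Cexp [complex.Re _]/= [complex.Im _]/= expRM_natl cos0 sin0 mulr1 mulr0.
  by rewrite /epow -CexpD; congr Cexp; ring.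
have x_neq0 k : x k != 0.
  apply/eqP => xk0; have := CexpD (2%:R * pi%:C * 'i * (la k + 1) / p%:R)
    (- (2%:R * pi%:C * 'i * (la k + 1) / p%:R)).
  rewrite subrr Cexp0 -[Cexp (_ / _)]/(x k) xk0 mul0r => /eqP.
  by rewrite oner_eq0.
have x_inj : injective x.
  move=> j k; rewrite !xE; have e0 : epow p (1 : R[i]) != 0.
    by apply/eqP => e0; have := x_neq0 0; rewrite xE e0 mul0r eqxx.
  move=> /(mulfI e0) /(congr1 (@complex.Re R)) /=.
  have r1 : r != 1.
    by rewrite lt_eqF // expR_lt1 oppr_lt0 divr_gt0 ?mulr_gt0 ?pi_gt0 ?ltr0n.
  by move=> /(ieexprIn (expR_gt0 _) r1) [].
have Dr k : root D (x k).
  have /matrixP /(_ (Ordinal p0) (Ordinal p0)) := etrans (esym (HP _ (la_typ k)))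
    (HQ _ (la_typ k)).
  rewrite !mxE eqxx !mulr1n -/(x k) => /eqP.
  rewrite eqr_div ?expf_neq0 // => /eqP PQ.
  by rewrite /root /D !hornerE PQ subrr.
have := @max_poly_roots _ D [seq x k | k <- iota 0 (size D)] D0.
rewrite size_map size_iota ltnn map_inj_uniq ?iota_uniq // => H.
suff : false by []; apply: H => //.
by apply/allP => _ /mapP [k _ ->].
Qed.

Fixpoint tpow s (T : tangle s s) (n : nat) : tangle s s :=
  if n is m.+1 then tcomp T (tpow T m) else tid s.

Definition right_closure (T : tangle [:: Up; Up] [:: Up; Up]) :
    tangle [:: Up] [:: Up] :=
  tcomp (ttens (tid [:: Up]) tevr)
    (tcomp (ttens T (tid [:: Down])) (ttens (tid [:: Up]) tcoev)).

(* Closing the second strand of sigma_1^{2t+1} gives T_(2,2t+1) with framing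
   2t+1, which is cancelled by 2t+1 negative kinks. *)
Definition torus_tangle (t : nat) : tangle [:: Up] [:: Up] :=
  tcomp (right_closure (tpow tpos (2 * t + 1)))
        (tpow (right_closure tneg) (2 * t + 1)).

Definition qpoch (A : nzRingType) (a q : A) (n : nat) : A :=
  \prod_(i < n) (1 - a * q ^+ i).

(* Polynomials in q; both divisions are exact. *)
Section QBinomial.
Variable F : fieldType.

Definition qint (n : nat) : {poly F} := (1 - 'X^n) %/ (1 - 'X).
Definition qfact (n : nat) : {poly F} := \prod_(1 <= i < n.+1) qint i.
Definition qbinom (n k : nat) : {poly F} :=
  qfact n %/ (qfact k * qfact (n - k)).

End QBinomial.

Section Formula.
Variables (R : realType) (t p : nat).

Let q : R[i] := epow p 1.
Let x : {fraction {poly R[i]}} := tofrac 'X.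
Let cst (c : R[i]) : {fraction {poly R[i]}} := tofrac c%:P.

(* k_i is the (i-1)-st entry of the tuple k *)
Definition torus_formula : {fraction {poly R[i]}} :=
  cst (q ^+ t) * x ^ (t%:Z * (1 - p%:Z)) *
  \sum_(k : t.-tuple 'I_p | sorted leq (map val k))
    let K i := nth 0%N (map val k) i.-1 in
    qpoch (x * cst q) (cst q) (K t) * x ^+ K t *
    \prod_(1 <= i < t)
      (cst (q ^+ (K i * (K i + 1))) * x ^+ (2 * K i)
       * cst (qbinom R[i] (K i.+1) (K i)).[q]).

End Formula.

(* Main.v *)
(* Put q = e_p, z = v^(-2 lambda) and x = q^(lambda+1), so z = q/x.  Both closures
   give scalars, so it suffices to compute one diagonal entry of each.

   On the vectors Delta(F)^(k-j) (v_0 (x) v_j) the full twist c^2 is triangular, by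
   the q-Chu-Vandermonde sum, and its coefficients are, up to telescoping factors,
   [k, j] q^(j(j+1)) x^(-2j).  Hence the entry of c^(2t+1) at v_0 (x) v_b is a sum
   over chains b = k_t >= ... >= k_1 >= 0, and the trace over b is the formula of
   the theorem with x replaced by 1/x.

   The invariance of the formula under x |-> 1/x is a q-series identity.  The inner
   sums form a Bailey chain relative to a = q x^2; summing over b with the conjugate
   Bailey pair (q-Chu-Vandermonde again, which terminates as q^p = 1) gives
     (1 - x) (1 + x^p) sum
       = sum_(n < p) (-1)^n q^(n(n-1)/2 + t n(n+1)) x^((2t+1)n) (1 - x^2 q^(2n+1)),
   where x |-> 1/x amounts to n |-> p - 1 - n. *)

Require Import Defs.
From mathcomp Require Import all_boot all_order all_algebra.
From mathcomp Require Import reals trigo exp complex mxtens.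
From mathcomp Require Import ring zify.

Set Implicit Arguments.
Unset Strict Implicit.
Unset Printing Implicit Defensive.

Import Order.TTheory GRing.Theory Num.Theory.
Local Open Scope ring_scope.
Local Open Scope complex_scope.

(** * q-series *)

(** One relation carries the representation theory: the braiding c commutes with Delta(F). It makes
    the full twist triangular, lets its coefficients be reused after applying powers of Delta(F),
    and forces the partial traces to be scalar. The entry at v_0 (x) v_b is chosen because that row
    of c is monomial: the odd factor c turns the covector of v_0 (x) v_b into that of v_b (x) v_0,
    which Delta(F) merely shifts. The sums at x and at 1/x do not agree term by term, and the Bailey
    argument that relates them divides by 1 - x^2 q^k, 1 - x and 1 + x^p, which vanish at some
    complex x. The symmetry is therefore proved over a field under x^(2p) != 1 and used only for the
    indeterminate of C(x); complex values are reached by evaluating a polynomial numerator. *)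

Lemma qpochS (A : nzRingType) (a q : A) n :
  qpoch a q n.+1 = (1 - a) * qpoch (a * q) q n.
Proof.
rewrite /qpoch big_ord_recl expr0 mulr1; congr (_ * _).
by apply: eq_bigr => i _; rewrite -mulrA -exprS.
Qed.

Lemma qpoch_recr (A : nzRingType) (a q : A) n :
  qpoch a q n.+1 = qpoch a q n * (1 - a * q ^+ n).
Proof. by rewrite /qpoch big_ord_recr. Qed.

Lemma qpoch0 (A : nzRingType) (a q : A) : qpoch a q 0 = 1.
Proof. by rewrite /qpoch big_ord0. Qed.

Lemma qpochD (A : nzRingType) (a q : A) m n :
  qpoch a q (m + n) = qpoch a q m * qpoch (a * q ^+ m) q n.
Proof.
rewrite /qpoch big_split_ord /=; congr (_ * _); apply: eq_bigr => i _.
by rewrite -mulrA -exprD.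
Qed.

(** * q-binomials, the q-Chu-Vandermonde sum and the Bailey chain *)

Section QBinomialRing.
Variables (A : comNzRingType) (q : A).

(** Defined by the q-Pascal rule rather than by q-factorials, so that it exists in any commutative
    ring and for any q. *)
Fixpoint qbin n k : A :=
  match n, k with
  | _, 0 => 1
  | 0, _.+1 => 0
  | n'.+1, k'.+1 => qbin n' k'.+1 + q ^+ (n' - k') * qbin n' k'
  end.

Lemma qbinSr n k :
  qbin n.+1 k.+1 = qbin n k.+1 + q ^+ (n - k) * qbin n k.
Proof. by []. Qed.

Lemma qbin0 n : qbin n 0 = 1. Proof. by case: n. Qed.

Lemma qbin_small n k : (n < k)%N -> qbin n k = 0.
Proof.
elim: n k => [|n IH] [|k] //= h.
by rewrite !IH ?mulr0 ?addr0 // ltnW.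
Qed.

Lemma qbinnn n : qbin n n = 1.
Proof. by elim: n => //= n ->; rewrite qbin_small // subnn add0r mulr1. Qed.

(** The second q-Pascal rule, derived from the first alone: for a general q no q-factorials can be
    cancelled. *)
Lemma qbinSl n k : qbin n.+1 k.+1 = q ^+ k.+1 * qbin n k.+1 + qbin n k.
Proof.
elim: n k => [|n IH] [|k]; try by rewrite /=; ring.
  rewrite -[LHS]/(qbin n.+1 1 + q ^+ (n.+1 - 0) * 1) {1}IH /= qbin0 !subn0.
  by rewrite !exprS; ring.
transitivity (qbin n.+1 k.+2 + q ^+ (n - k) * qbin n.+1 k.+1) => //.
rewrite {1}(IH k.+1) {1}(IH k) /=.
have [kn|kn] := ltnP k n; last by rewrite (@qbin_small n k.+1) //; ring.
by rewrite -[(n - k)%N]prednK ?subn_gt0 // -subnS !exprS; ring.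
Qed.

Lemma qbin_qpoch n m :
  qbin (n + m) m * qpoch q q m = qpoch (q ^+ n.+1) q m.
Proof.
elim: m n => [|m IHm] n; first by rewrite qbin0 !qpoch0 mulr1.
elim: n => [|n IHn]; first by rewrite add0n qbinnn expr1 mul1r.
rewrite -[qbin _ _]/(qbin (n + m.+1) m.+1 + q ^+ (n + m.+1 - m) * qbin (n + m.+1) m).
rewrite mulrDl IHn -addSnnS addnK.
have -> : q ^+ n.+1 * qbin (n.+1 + m) m * qpoch q q m.+1
    = q ^+ n.+1 * (1 - q ^+ m.+1) * (qbin (n.+1 + m) m * qpoch q q m).
  by rewrite qpoch_recr !exprS; ring.
by rewrite IHm qpochS qpoch_recr -exprSr !exprS; ring.
Qed.

Lemma qbin_fact n m :
  qbin (n + m) m * (qpoch q q m * qpoch q q n) = qpoch q q (n + m).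
Proof. by rewrite mulrA qbin_qpoch qpochD exprS mulrC. Qed.

(* The q-Chu-Vandermonde sum, with (A;q)_m B^m written as a product in B and
   C = AB so that A = oo is allowed: it is the case B = 0. *)
Lemma q_vandermonde N (B C : A) :
  \sum_(m < N.+1) qbin N m * (-1) ^+ m * q ^+ 'C(m, 2)
     * (\prod_(i < m) (B - C * q ^+ i)) * qpoch (C * q ^+ m) q (N - m)
  = qpoch B q N.
Proof.
elim: N C => [|N IH] C.
  by rewrite big_ord1 big_ord0 !qpoch0 !mulr1.
rewrite qpoch_recr.
(* The last factor is split as 1 - B q^N = (1 - C q^N) - (B - C) q^N. The induction hypothesis at C
   and at C q then supplies the two terms of the q-Pascal rule. *)
transitivity ((1 - C * q ^+ N) * qpoch B q N - (B - C) * q ^+ N * qpoch B q N);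
  last by ring.
rewrite -{1}(IH C) -(IH (C * q)) !mulr_sumr.
pose T m := qbin N m * (-1) ^+ m * q ^+ 'C(m, 2)
  * (\prod_(i < m) (B - C * q ^+ i)) * qpoch (C * q ^+ m) q (N.+1 - m).
transitivity (\sum_(m < N.+2) T m + \sum_(m < N.+1)
   q ^+ (N - m) * qbin N m * (-1) ^+ m.+1 * q ^+ 'C(m.+1, 2)
   * (\prod_(i < m.+1) (B - C * q ^+ i)) * qpoch (C * q ^+ m.+1) q (N - m)).
  rewrite big_ord_recl [in RHS]big_ord_recl -addrA; congr (_ + _).
    by rewrite /T /= qbin0.
  rewrite -big_split; apply: eq_bigr => m _ /=.
  by rewrite /T /bump /= add1n subSS; ring.
rewrite big_ord_recr {2}/T qbin_small //= !mul0r addr0; congr (_ + _).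
  apply: eq_bigr => m _; have mN : (m <= N)%N by rewrite -ltnS.
  rewrite /T subSn // qpoch_recr -[C * _ * _]mulrA -exprD subnKC //.
  by ring.
rewrite -sumrN; apply: eq_bigr => m _; have mN : (m <= N)%N by rewrite -ltnS.
rewrite big_ord_recl expr0 mulr1 binS bin1 exprD.
under [in LHS]eq_bigr => i _ do rewrite lift0 exprS mulrA.
have -> : q ^+ N = q ^+ (N - m) * q ^+ m by rewrite -exprD subnK.
have -> : C * q ^+ m.+1 = C * q * q ^+ m by rewrite exprS mulrA.
by rewrite [in LHS]exprS; ring.
Qed.

(** At B = 0 the product in [q_vandermonde] is (-1)^m C^m q^C(m,2), so the signs cancel and the
    exponent doubles to m(m-1). Both the step of the Bailey chain and the full twist reduce to this
    sum. *)
Lemma durfee N (C : A) :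
  \sum_(m < N.+1) qbin N m * q ^+ (m * m.-1) * C ^+ m
     * qpoch (C * q ^+ m) q (N - m) = 1.
Proof.
transitivity (qpoch 0 q N); last first.
  by rewrite /qpoch big1 // => i _; rewrite mul0r subr0.
rewrite -(q_vandermonde N 0 C); apply: eq_bigr => m _; congr (_ * _).
have -> : \prod_(i < m) (0 - C * q ^+ i) = (-1) ^+ m * C ^+ m * q ^+ 'C(m, 2).
  elim: (m : nat) => [|k IH]; first by rewrite big_ord0 !expr0 !mulr1.
  by rewrite big_ord_recr IH /= binS bin1 exprD !exprS; ring.
have -> : (m * m.-1 = 'C(m, 2) + 'C(m, 2))%N.
  rewrite addnn bin2 -[LHS]odd_double_half -[RHS]add0n.
  by case: (m : nat) => //= k; rewrite oddM /= andNb.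
rewrite exprD -[LHS]mulr1 -[X in _ * X = _](sqrr_sign A m) expr2; ring.
Qed.

(* Up to the factor (q;q)_b, the Bailey chain relative to q X^2 which starts at
   the unit Bailey pair. *)
Fixpoint bailey X t b : A :=
  if t is t'.+1 then
    \sum_(j < b.+1) qbin b j * q ^+ (j * (j + 1)) * X ^+ (2 * j) * bailey X t' j
  else (b == 0)%:R.

(** The sum of the theorem without its prefactor, with b = k_t. X stays an argument because the
    trace supplies 1/x. *)
Definition torus_poly p X t : A :=
  \sum_(b < p) qpoch (q * X) q b * X ^+ b * bailey X t b.
End QBinomialRing.

Arguments qbin : simpl never.

Lemma sum_shift (V : nmodType) n b (f : nat -> V) :
  (n <= b)%N -> (forall j, (j < n)%N -> f j = 0) ->
  \sum_(j < b.+1) f j = \sum_(i < (b - n).+1) f (n + i)%N.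
Proof.
move=> nb f0; rewrite -(big_mkord xpredT f) (big_cat_nat (n := n)) //=; last first.
  exact: leqW.
rewrite big_nat_cond big1 ?add0r; last by move=> j; rewrite andbT; exact: f0.
rewrite -{1}[n]add0n big_addn subSn // big_mkord.
by apply: eq_bigr => i _; rewrite addnC.
Qed.

(** * Products of q-binomials where q-factorials can be cancelled *)

Section QBinomialDomain.
Variables (A : idomainType) (q : A).

(** Both sides are the q-multinomial coefficient of (n, j, l), by cancelling q-factorials. For q of
    order p the condition is met as long as n + j + l < p. *)
Lemma qbin_subset n j l : qpoch q q (n + j + l) != 0 ->
  qbin q (n + j + l) (n + j) * qbin q (n + j) n
  = qbin q (n + j + l) n * qbin q (j + l) j.
Proof.
move=> h; have h' : qpoch q q n * qpoch q q j * qpoch q q l != 0.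
  apply: contra h => /eqP h.
  rewrite [(n + j + l)%N]addnC -qbin_fact [(n + j)%N]addnC -qbin_fact.
  apply/eqP; transitivity (qbin q (l + (j + n)) (j + n) * qbin q (j + n) n
    * (qpoch q q n * qpoch q q j * qpoch q q l)); first by ring.
  by rewrite h mulr0.
apply: (mulIf h').
transitivity (qpoch q q (n + j + l)).
  rewrite [(n + j + l)%N]addnC -qbin_fact [(n + j)%N]addnC -(qbin_fact q j n).
  by ring.
rewrite [(n + j + l)%N]addnAC [(n + l + j)%N]addnAC -[(n + j + l)%N]addnA.
rewrite [(n + _)%N]addnC -(qbin_fact q (j + l)) [(j + l)%N]addnC -(qbin_fact q l j).
by ring.
Qed.

Lemma qbin_sym n m : qpoch q q (n + m) != 0 -> qbin q (n + m) n = qbin q (n + m) m.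
Proof.
move=> h; have h' : qpoch q q m * qpoch q q n != 0.
  by apply: contra h => /eqP h; rewrite -qbin_fact h mulr0.
apply: (mulIf h'); rewrite qbin_fact [(n + m)%N]addnC -(qbin_fact q m n).
by congr (_ * _); rewrite mulrC.
Qed.

Lemma qbin_disjoint n j l : qpoch q q (n + j + l) != 0 ->
  qbin q (n + j + l) j * qbin q (n + l) n
  = qbin q (n + j + l) n * qbin q (j + l) j.
Proof.
move=> h; rewrite -(qbin_subset h) (@qbin_sym n j); last first.
  by apply: contra h => /eqP h; rewrite qpochD h mul0r.
by have := @qbin_subset j n l; rewrite [(j + n)%N]addnC => ->.
Qed.
End QBinomialDomain.

(** * Bailey pairs and the symmetry X |-> 1/X at a primitive p-th root of unity *)

Section RootOfUnity.
Variables (K : fieldType) (p : nat) (q : K).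
Hypothesis q_prim : p.-primitive_root q.

Let p_gt0 : (0 < p)%N. Proof. exact: prim_order_gt0 q_prim. Qed.

Lemma qpoch_neq0 n : (n < p)%N -> qpoch q q n != 0.
Proof.
move=> np; apply/prodf_neq0 => i _; rewrite -exprS subr_eq0 eq_sym.
rewrite -(prim_order_dvd q_prim) gtnNdvd //.
by apply: leq_ltn_trans np; apply: ltn_ord.
Qed.

(** The factorization of X^p - 1 over the powers of q, read at 1/a. *)
Lemma qpoch_full a : qpoch a q p = 1 - a ^+ p.
Proof.
have [->|a0] := eqVneq a 0.
  rewrite expr0n eqn0Ngt p_gt0 subr0 /qpoch big1 // => i _.
  by rewrite mul0r subr0.
have := congr1 (fun P : {poly K} => P.[a^-1]) (factor_Xn_sub_1 q_prim).
rewrite horner_prod !hornerE => h.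
have -> : 1 - a ^+ p = a ^+ p * (a^-1 ^+ p - 1).
  by rewrite exprVn mulrBr divff ?expf_neq0 // mulr1.
have -> : a ^+ p = \prod_(i < p) a by rewrite prodr_const card_ord.
rewrite -h /qpoch big_mkord -big_split.
by apply: eq_bigr => i _; rewrite /= !hornerE mulrBr divff.
Qed.

(* The sum of all b + 2 terms vanishes: this is the unit Bailey pair relative to c. *)
Lemma unit_bailey_pair (c : K) b m : (forall k, 1 - c * q ^+ k != 0) ->
  \sum_(n < m.+1) qbin q b.+1 n * (-1) ^+ n * q ^+ 'C(n, 2)
     * (1 - c * q ^+ (2 * n)) / qpoch (c * q ^+ n) q b.+2
  = (-1) ^+ m * q ^+ 'C(m.+1, 2) * qbin q b m / qpoch (c * q ^+ m.+1) q b.+1.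
Proof.
move=> c0.
have qc0 k n : qpoch (c * q ^+ k) q n != 0.
  by apply/prodf_neq0 => i _; rewrite -mulrA -exprD.
elim: m => [|m IH].
  rewrite big_ord1 !qbin0 !expr0 !mulr1 expr1 !mul1r [in LHS]qpochS.
  by rewrite invfM mulrA divff ?mul1r // -[c]mulr1 -[X in c * X](expr0 q).
(* Both q-Pascal rules at once: in the new summand, the part with [b, m] cancels the previous
   partial sum and the part with [b, m+1] is the next one. *)
have key : qbin q b.+1 m.+1 * (1 - c * q ^+ (2 * m.+1))
    = q ^+ m.+1 * qbin q b m.+1 * (1 - c * q ^+ m.+1)
      + qbin q b m * (1 - c * q ^+ (m.+2 + b)).
  rewrite mulrBr mulr1 {1}qbinSl qbinSr mul2n -addnn.
  have [mb|mb] := leqP m b; last by rewrite !qbin_small ?leqW //; ring.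
  have eb : q ^+ b = q ^+ (b - m) * q ^+ m by rewrite -exprD subnK.
  by rewrite !exprD eb !exprS; ring.
rewrite big_ord_recr IH /=.
have c1 : 1 - c * q ^+ m.+1 != 0 by [].
have c2 : 1 - c * q ^+ (m.+2 + b) != 0 by [].
have cD := qc0 m.+2 b.
have -> : qpoch (c * q ^+ m.+1) q b.+2 = (1 - c * q ^+ m.+1) *
    (qpoch (c * q ^+ m.+2) q b * (1 - c * q ^+ (m.+2 + b))).
  by rewrite qpochS -[c * _ * q]mulrA -exprSr qpoch_recr -[c * _ * _]mulrA -exprD.
have -> : qpoch (c * q ^+ m.+1) q b.+1
    = (1 - c * q ^+ m.+1) * qpoch (c * q ^+ m.+2) q b.
  by rewrite qpochS -[c * _ * q]mulrA -exprSr.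
have -> : qpoch (c * q ^+ m.+2) q b.+1
    = qpoch (c * q ^+ m.+2) q b * (1 - c * q ^+ (m.+2 + b)).
  by rewrite qpoch_recr -[c * _ * _]mulrA -exprD.
transitivity ((-1) ^+ m * q ^+ 'C(m.+1, 2) *
   (qbin q b m * (1 - c * q ^+ (m.+2 + b)) - qbin q b.+1 m.+1 * (1 - c * q ^+ (2 * m.+1)))
   / ((1 - c * q ^+ m.+1) * (qpoch (c * q ^+ m.+2) q b * (1 - c * q ^+ (m.+2 + b))))).
  rewrite [(-1) ^+ m.+1]exprS; field; exact/and3P.
rewrite key [in RHS]binS bin1 [in RHS]exprD [(-1) ^+ m.+1]exprS.
field; exact/and3P.
Qed.

(** Bailey's lemma iterated from the unit pair: with a = q X^2, each step multiplies the n-th term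
    by a^n q^(n^2) = X^(2n) q^(n(n+1)). After exchanging the sums, [durfee] evaluates the inner
    one. *)
Lemma bailey_sum X t b : (b < p)%N -> (forall k, 1 - X ^+ 2 * q ^+ k != 0) ->
  bailey q X t b = \sum_(n < b.+1) qbin q b n * (-1) ^+ n * q ^+ 'C(n, 2)
     * (1 - X ^+ 2 * q ^+ (2 * n).+1) * (X ^+ (2 * n) * q ^+ (n * (n + 1))) ^+ t
     / qpoch (X ^+ 2 * q ^+ n.+1) q b.+1.
Proof.
move=> bp X0.
have qX0 k n : qpoch (X ^+ 2 * q ^+ k) q n != 0.
  by apply/prodf_neq0 => i _; rewrite -mulrA -exprD.
elim: t b bp => [|t IH] b bp.
  case: b bp => [|b] bp /=.
    rewrite big_ord1 !expr0 !mulr1 /qpoch big_ord1 expr0 mulr1 qbin0 !mul1r.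
    by rewrite divff.
  have := @unit_bailey_pair (X ^+ 2 * q) b b.+1; rewrite (@qbin_small _ _ b) //.
  rewrite mulr0 mul0r => /(_ _)/esym h.
  rewrite [LHS]h; last by move=> k; rewrite -mulrA -exprS.
  apply: eq_bigr => n _; rewrite expr0 mulr1 -!mulrA -!exprS.
  by rewrite !mulrA.
rewrite /=.
pose f j n := qbin q b j * q ^+ (j * (j + 1)) * X ^+ (2 * j) * (qbin q j n
  * (-1) ^+ n * q ^+ 'C(n, 2) * (1 - X ^+ 2 * q ^+ (2 * n).+1)
  * (X ^+ (2 * n) * q ^+ (n * (n + 1))) ^+ t / qpoch (X ^+ 2 * q ^+ n.+1) q j.+1).
have f0 j n : (j < n)%N -> f j n = 0.
  by move=> jn; rewrite /f (@qbin_small _ _ j n) // !mul0r mulr0.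
transitivity (\sum_(j < b.+1) \sum_(n < b.+1) f j n).
  apply: eq_bigr => j _; rewrite IH; last exact: leq_ltn_trans (leq_ord j) bp.
  rewrite mulr_sumr -[LHS]/(\sum_(n < j.+1) f j n).
  rewrite (big_ord_widen b.+1 (f j)) // [RHS](bigID (fun n : 'I_ _ => (n < j.+1)%N)) /=.
  by rewrite [X in _ + X]big1 ?addr0 // => n; rewrite -leqNgt; exact: f0.
rewrite exchange_big; apply: eq_bigr => n _ /=.
have nb : (n <= b)%N by rewrite -ltnS.
rewrite (@sum_shift _ n b (f^~ n)) //; last by move=> j; exact: f0.
(* With j = n + i the denominator is (X^2 q^(n+1);q)_(n+1) (C;q)_i, which leaves a [durfee] sum of
   length M in i. *)
pose M := (b - n)%N; pose C := X ^+ 2 * q ^+ (2 * n).+2.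
have C0 k : qpoch C q k != 0 by apply: qX0.
have split k : qpoch (X ^+ 2 * q ^+ n.+1) q (n + k).+1
    = qpoch (X ^+ 2 * q ^+ n.+1) q n.+1 * qpoch C q k.
  by rewrite -addSn qpochD -[X ^+ 2 * _ * _]mulrA -exprD addnS addSn addnn -mul2n.
transitivity (\sum_(i < M.+1) (qbin q M i * q ^+ (i * i.-1) * C ^+ i / qpoch C q i)
  * (qbin q b n * (-1) ^+ n * q ^+ 'C(n, 2) * (1 - X ^+ 2 * q ^+ (2 * n).+1)
     * (X ^+ (2 * n) * q ^+ (n * (n + 1))) ^+ t.+1 / qpoch (X ^+ 2 * q ^+ n.+1) q n.+1)).
  apply: eq_bigr => i _; rewrite /f split.
  have iM : (i <= M)%N by rewrite -ltnS.
  have eb : b = (n + i + (M - i))%N by rewrite /M -addnA subnKC // subnKC.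
  have e1 : qbin q b (n + i) * qbin q (n + i) n = qbin q b n * qbin q M i.
    have := @qbin_subset _ q n i (M - i); rewrite -eb subnKC //.
    by apply; exact: qpoch_neq0.
  rewrite invfM.
  have e2 : q ^+ ((n + i) * (n + i + 1)) * X ^+ (2 * (n + i))
    = q ^+ (i * i.-1) * C ^+ i * (X ^+ (2 * n) * q ^+ (n * (n + 1))).
    rewrite /C exprMn -!exprM.
    transitivity (X ^+ (2 * n) * X ^+ (2 * i) *
        (q ^+ (i * i.-1) * q ^+ ((2 * n).+2 * i) * q ^+ (n * (n + 1)))); last by ring.
    rewrite -!exprD mulrC -mulnDr; congr (_ * q ^+ _).
    by case: (i : nat) => [|k] /=; lia.
  rewrite [_ ^+ t.+1]exprS.
  transitivity ((qbin q b (n + i) * qbin q (n + i) n) *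
    (q ^+ ((n + i) * (n + i + 1)) * X ^+ (2 * (n + i))) * ((-1) ^+ n
    * q ^+ 'C(n, 2) * (1 - X ^+ 2 * q ^+ (2 * n).+1)
    * (X ^+ (2 * n) * q ^+ (n * (n + 1))) ^+ t
    * ((qpoch (X ^+ 2 * q ^+ n.+1) q n.+1)^-1 * (qpoch C q i)^-1))); first by ring.
  by rewrite e1 e2; ring.
rewrite -mulr_suml.
have -> : \sum_(i < M.+1) (qbin q M i * q ^+ (i * i.-1) * C ^+ i / qpoch C q i)
   = (qpoch C q M)^-1.
  apply: (mulIf (C0 M)); rewrite mulVf // -[RHS](durfee q M C) mulr_suml.
  apply: eq_bigr => i _; have iM : (i <= M)%N by rewrite -ltnS.
  have -> : qpoch C q M = qpoch C q i * qpoch (C * q ^+ i) q (M - i).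
    by rewrite -qpochD subnKC.
  by rewrite mulrA divfK.
have -> : qpoch (X ^+ 2 * q ^+ n.+1) q b.+1
   = qpoch (X ^+ 2 * q ^+ n.+1) q n.+1 * qpoch C q M by rewrite -split subnKC.
by rewrite invfM; ring.
Qed.

(* [n + m, n] at the root of unity, as 1 - q^(n+1+i) = - q^(n+1+i) (1 - q^(N-i))
   for N = p - 1 - n *)
Lemma qbin_root n m : (n + m < p)%N ->
  qbin q (n + m) n
  = (-1) ^+ m * q ^+ (n.+1 * m) * q ^+ 'C(m, 2) * qbin q (p.-1 - n) m.
Proof.
move=> nmp; have np : (n < p)%N := leq_ltn_trans (leq_addr _ _) nmp.
have mp : (m < p)%N := leq_ltn_trans (leq_addl _ _) nmp.
rewrite qbin_sym ?qpoch_neq0 //; apply: (mulIf (qpoch_neq0 mp)).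
rewrite qbin_qpoch.
have [l el] : exists l, (p.-1 - n = l + m)%N by exists (p.-1 - n - m)%N; lia.
rewrite el -[_ * _ * qpoch q q m]mulrA (qbin_qpoch q l m).
have -> : qpoch (q ^+ l.+1) q m = \prod_(i < m) (1 - q ^+ (l + m - i)).
  rewrite /qpoch (reindex_inj rev_ord_inj) /=; apply: eq_bigr => i _.
  by rewrite -exprD; congr (1 - q ^+ _); have := ltn_ord i; lia.
have h k : (k <= m)%N -> qpoch (q ^+ n.+1) q k = (-1) ^+ k * q ^+ (n.+1 * k)
    * q ^+ 'C(k, 2) * \prod_(i < k) (1 - q ^+ (l + m - i)).
  elim: k => [|k IH] km; first by rewrite qpoch0 big_ord0 muln0 !expr0 !mulr1.
  rewrite qpoch_recr IH 1?ltnW // big_ord_recr /= binS bin1 mulnS !exprD.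
  have -> : 1 - q ^+ n.+1 * q ^+ k = - (q ^+ n.+1 * q ^+ k * (1 - q ^+ (l + m - k))).
    rewrite mulrBr mulr1 -!exprD.
    have -> : (n.+1 + k + (l + m - k) = p)%N by lia.
    by rewrite (prim_expr_order q_prim) opprB.
  by rewrite [(-1) ^+ k.+1]exprS; ring.
by rewrite h // mulrC.
Qed.

(** [qbin_disjoint] pulls [k, n] out of the sum and [durfee] with N = k - n evaluates the rest. In
    [full_twist] this compares the coefficients of v_n (x) v_(k-n). *)
Lemma twist_sum (z : K) k n : (n <= k < p)%N ->
  \sum_(j < k.+1) qbin q k j * (z ^+ j * q ^+ (j * j.-1) * qpoch (z * q ^+ j) q (k - j))
     * qbin q (k - j) n
  = qbin q k n * qpoch (z * q ^+ (k - n)) q n.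
Proof.
move=> /andP [nk kp]; pose M := (k - n)%N.
pose f j := qbin q k j * (z ^+ j * q ^+ (j * j.-1) * qpoch (z * q ^+ j) q (k - j))
     * qbin q (k - j) n.
transitivity (\sum_(j < M.+1) f j).
  have Mk : (M.+1 <= k.+1)%N by rewrite ltnS leq_subr.
  rewrite [RHS](big_ord_widen _ _ Mk) [RHS]big_mkcond; apply: eq_bigr => j _ /=.
  case: ltnP => // Mj; rewrite (@qbin_small _ _ (k - j)) ?mulr0 //.
  by rewrite /M in Mj; have := ltn_ord j; lia.
transitivity (\sum_(j < M.+1) qbin q k n * qpoch (z * q ^+ M) q n
    * (qbin q M j * q ^+ (j * j.-1) * z ^+ j * qpoch (z * q ^+ j) q (M - j))).
  apply: eq_bigr => j _; rewrite /f.
  have jM : (j <= M)%N by rewrite -ltnS.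
  have := @qbin_disjoint _ q n j (M - j).
  have -> : (n + j + (M - j) = k)%N by rewrite -addnA subnKC // subnKC.
  have -> : (n + (M - j) = k - j)%N by rewrite addnBA // subnKC.
  rewrite subnKC // => /(_ (qpoch_neq0 kp)) h.
  have -> : qpoch (z * q ^+ j) q (k - j)
     = qpoch (z * q ^+ j) q (M - j) * qpoch (z * q ^+ M) q n.
    have -> : (k - j = M - j + n)%N by rewrite addnC addnBA // subnKC.
    by rewrite qpochD -mulrA -exprD subnKC.
  rewrite mulrAC h; ring.
by rewrite -mulr_sumr durfee mulr1.
Qed.

Lemma qbin_step k n : (n < k < p)%N ->
  qbin q k n.+1 * (1 - q ^+ n.+1) = qbin q k n * (1 - q ^+ (k - n)).
Proof.
move=> /andP [nk kp].
have [l ->] : exists l, k = (l + n.+1)%N by exists (k - n.+1)%N; lia.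
have q0 : qpoch q q n != 0 by apply: qpoch_neq0; lia.
apply: (mulIf q0).
transitivity (qbin q (l + n.+1) n.+1 * qpoch q q n.+1).
  by rewrite qpoch_recr exprS; ring.
rewrite qbin_qpoch qpochS -exprSr -qbin_qpoch addSnnS.
have -> : (l + n.+1 - n = l.+1)%N by lia.
by ring.
Qed.

Section Generic.
Variable X : K.
Hypothesis X_gen : X ^+ (2 * p) != 1.

(** The p-th power of X^2 q^k is X^(2p), so one inequality controls all Bailey denominators. *)
Lemma generic_sq_neq0 k : 1 - X ^+ 2 * q ^+ k != 0.
Proof.
rewrite subr_eq0; apply: contra X_gen => /eqP h.
have : (X ^+ 2 * q ^+ k) ^+ p = 1 by rewrite -h expr1n.
rewrite exprMn [q ^+ k ^+ p]exprAC (prim_expr_order q_prim) expr1n mulr1.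
by rewrite -exprM => ->.
Qed.

Lemma generic_neq1 : 1 - X != 0.
Proof.
rewrite subr_eq0; apply: contra X_gen => /eqP <-; by rewrite expr1n.
Qed.

Lemma generic_exp_neqN1 : 1 + X ^+ p != 0.
Proof.
rewrite addrC addr_eq0; apply: contra X_gen => /eqP h.
by rewrite mulnC exprM h sqrrN expr1n.
Qed.

(** At the root of unity [qbin_root] turns [n+i, n] into a multiple of [p-1-n, i], so the sum
    becomes [q_vandermonde] with B = X q^(n+1) and C = X^2 q^(2n+2). Its value joins the prefactors
    to form the complete products (qX;q)_(p-1) and (X^2 q^(n+1);q)_p. *)
Lemma conjugate_bailey n : (n < p)%N ->
  \sum_(b < p) qpoch (q * X) q b * X ^+ b * qbin q b n
      / qpoch (X ^+ 2 * q ^+ n.+1) q b.+1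
  = X ^+ n / ((1 - X) * (1 + X ^+ p)).
Proof.
move=> np; pose N := (p.-1 - n)%N; pose C := X ^+ 2 * q ^+ (2 * n).+2.
have qX0 k m : qpoch (X ^+ 2 * q ^+ k) q m != 0.
  by apply/prodf_neq0 => i _; rewrite -mulrA -exprD generic_sq_neq0.
have C0 k : qpoch C q k != 0 by apply: qX0.
have split k : qpoch (X ^+ 2 * q ^+ n.+1) q (n + k).+1
    = qpoch (X ^+ 2 * q ^+ n.+1) q n.+1 * qpoch C q k.
  by rewrite -addSn qpochD -[X ^+ 2 * _ * _]mulrA -exprD addnS addSn addnn -mul2n.
pose f b := qpoch (q * X) q b * X ^+ b * qbin q b n
      / qpoch (X ^+ 2 * q ^+ n.+1) q b.+1.
have ep : p = p.-1.+1 by rewrite prednK.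
transitivity (\sum_(b < p.-1.+1) f b); first by rewrite -ep.
rewrite (@sum_shift _ n); last 2 first.
- by lia.
- by move=> j jn; rewrite /f qbin_small // mulr0 mul0r.
rewrite -/N.
have V := q_vandermonde q N (X * q ^+ n.+1) C.
have qX_sp k : qpoch (q * X) q (n + k) = qpoch (q * X) q n * qpoch (X * q ^+ n.+1) q k.
  by rewrite qpochD exprS; congr (_ * qpoch _ _ _); ring.
transitivity (qpoch (q * X) q n * X ^+ n / qpoch (X ^+ 2 * q ^+ n.+1) q n.+1
    * (qpoch (X * q ^+ n.+1) q N / qpoch C q N)).
  rewrite -V mulr_suml mulr_sumr; apply: eq_bigr => i _.
  have iN : (i <= N)%N by rewrite -ltnS.
  have -> : qpoch C q N = qpoch C q i * qpoch (C * q ^+ i) q (N - i).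
    by rewrite -qpochD subnKC.
  rewrite /f split qX_sp qbin_root; last by lia.
  have -> : \prod_(j < i) (X * q ^+ n.+1 - C * q ^+ j)
     = X ^+ i * q ^+ (n.+1 * i) * qpoch (X * q ^+ n.+1) q i.
    have -> : X ^+ i * q ^+ (n.+1 * i) = \prod_(j < i) (X * q ^+ n.+1).
      by rewrite prodr_const card_ord exprM exprMn.
    rewrite -big_split.
    apply: eq_bigr => j _ /=; rewrite /C !exprS mulnC exprM expr2 expr0; ring.
  have C1 : qpoch (C * q ^+ i) q (N - i) != 0.
    by rewrite /C -mulrA -exprD.
  have D0 := qX0 n.+1 n.+1; have Ci := C0 i.
  rewrite exprD -/N; field. exact/and3P.
have nN : (n + N = p.-1)%N by rewrite subnKC // -ltnS -ep.
have num : qpoch (q * X) q p.-1 = (1 - X ^+ p) / (1 - X).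
  by rewrite -qpoch_full [in RHS]ep qpochS mulrAC divff ?generic_neq1 // mul1r [q * X]mulrC.
have den : qpoch (X ^+ 2 * q ^+ n.+1) q p = (1 - X ^+ p) * (1 + X ^+ p).
  rewrite qpoch_full exprMn [q ^+ n.+1 ^+ p]exprAC (prim_expr_order q_prim).
  by rewrite expr1n mulr1 -exprM mulnC exprM; ring.
have Xp : 1 - X ^+ p != 0.
  rewrite subr_eq0; apply: contra X_gen => /eqP h.
  by rewrite mulnC exprM -h expr1n.
have := qX_sp N; have := split N; rewrite nN -ep den num => dE nE.
transitivity (qpoch (q * X) q n * qpoch (X * q ^+ n.+1) q N * X ^+ n
    / (qpoch (X ^+ 2 * q ^+ n.+1) q n.+1 * qpoch C q N)); first by field; rewrite !qX0.
by rewrite -dE -nE; field; rewrite generic_neq1 generic_exp_neqN1.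
Qed.

Lemma torus_poly_closed t :
  (1 - X) * (1 + X ^+ p) * torus_poly q p X t
  = \sum_(n < p) (-1) ^+ n * q ^+ 'C(n, 2) * q ^+ (t * (n * (n + 1)))
     * X ^+ ((2 * t + 1) * n) * (1 - X ^+ 2 * q ^+ (2 * n).+1).
Proof.
transitivity ((1 - X) * (1 + X ^+ p) * \sum_(b < p) \sum_(n < p)
    (qpoch (q * X) q b * X ^+ b * qbin q b n / qpoch (X ^+ 2 * q ^+ n.+1) q b.+1)
    * ((-1) ^+ n * q ^+ 'C(n, 2) * (1 - X ^+ 2 * q ^+ (2 * n).+1)
       * (X ^+ (2 * n) * q ^+ (n * (n + 1))) ^+ t)).
  congr (_ * _); apply: eq_bigr => b _; rewrite bailey_sum //; last exact: generic_sq_neq0.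
  rewrite mulr_sumr.
  pose f (n : nat) := qpoch (q * X) q b * X ^+ b * (qbin q b n * (-1) ^+ n * q ^+ 'C(n, 2)
     * (1 - X ^+ 2 * q ^+ (2 * n).+1) * (X ^+ (2 * n) * q ^+ (n * (n + 1))) ^+ t
     / qpoch (X ^+ 2 * q ^+ n.+1) q b.+1).
  rewrite (big_ord_widen p f) // big_mkcond; apply: eq_bigr => n _ /=.
  rewrite /f; case: ltnP => bn; last by rewrite qbin_small //; ring.
  by ring.
rewrite exchange_big mulr_sumr; apply: eq_bigr => n _ /=.
rewrite -mulr_suml conjugate_bailey // exprMn -!exprM [((2 * t + 1) * n)%N]mulnDl.
rewrite mul1n exprD mulnAC [(t * _)%N]mulnC.
by field; rewrite generic_neq1 generic_exp_neqN1.
Qed.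
End Generic.

(** The first identity compares the two expressions that [qbin_root] gives for [p-1, n] = [p-1, m],
    which spares a distinction by the parity of p. The second holds because m + 1 = -n modulo p. *)
Lemma root_reflect n m : (n + m).+1 = p ->
  (-1) ^+ m * q ^+ 'C(m, 2) = (-1) ^+ n * q ^+ 'C(n, 2) * q ^+ (2 * n).+1
  /\ q ^+ (m * (m + 1)) = q ^+ (n * (n + 1)).
Proof.
move=> nm; have qp k : q ^+ (p * k) = 1.
  by rewrite exprM (prim_expr_order q_prim) expr1n.
have q0 k : q ^+ k != 0.
  rewrite expf_neq0 //; apply/eqP => q0; have := qp 1%N.
  by rewrite muln1 q0 expr0n eqn0Ngt p_gt0 => /eqP; rewrite eq_sym oner_eq0.
split; last first.
  transitivity (q ^+ (m * (m + 1)) * q ^+ (p * (2 * n).+1)); first by rewrite qp mulr1.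
  by rewrite -exprD -[RHS]mulr1 -(qp p) -exprD -nm; congr (q ^+ _); lia.
have e1 : qbin q (n + m) n = (-1) ^+ m * q ^+ (n.+1 * m) * q ^+ 'C(m, 2).
  by rewrite qbin_root -?nm //= addKn qbinnn mulr1.
have e2 : qbin q (n + m) n = (-1) ^+ n * q ^+ (m.+1 * n) * q ^+ 'C(n, 2).
  rewrite qbin_sym ?qpoch_neq0 -?nm // addnC qbin_root -?nm 1?addnC //=.
  by rewrite addKn qbinnn mulr1.
apply: (mulIf (q0 (n.+1 * m))); rewrite mulrAC -e1 e2.
transitivity ((-1) ^+ n * q ^+ 'C(n, 2) * (q ^+ (p * 1) * q ^+ (m.+1 * n))).
  by rewrite qp; ring.
rewrite -[RHS]mulrA -!exprD -nm; congr (_ * q ^+ _); lia.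
Qed.

(* The terms n and p - 1 - n of torus_poly_closed are exchanged by X |-> 1/X. *)
Lemma torus_poly_inv X t : X != 0 -> X ^+ (2 * p) != 1 ->
  torus_poly q p X^-1 t * X ^+ (2 * t * p.-1) = torus_poly q p X t.
Proof.
move=> X0 Xg; have Yg : X^-1 ^+ (2 * p) != 1.
  by rewrite exprVn invr_eq1.
have D0 : (1 - X) * (1 + X ^+ p) != 0 by rewrite mulf_neq0 ?generic_neq1 ?generic_exp_neqN1.
apply: (mulfI D0); rewrite torus_poly_closed // -[RHS]opprK -sumrN.
have ep : p = p.-1.+1 by rewrite prednK.
(* The factor X^(1+p) clears the inverses: (1 - 1/X) X = -(1 - X), whence the sign, and (1 + X^-p)
   X^p = 1 + X^p. *)
transitivity (- ((1 - X^-1) * (1 + X^-1 ^+ p) * torus_poly q p X^-1 t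
    * X ^+ (2 + (2 * t + 1) * p.-1))).
  have -> : (2 + (2 * t + 1) * p.-1 = 1 + p + 2 * t * p.-1)%N by lia.
  rewrite !exprD exprVn; field; rewrite X0 expf_neq0 //.
congr (- _); rewrite torus_poly_closed // mulr_suml (reindex_inj rev_ord_inj).
apply: eq_bigr => n _ /=; set m := (p - n.+1)%N.
have nm : (n + m).+1 = p by rewrite /m -addSn subnKC.
have [h1 h2] := root_reflect nm; rewrite h1.
rewrite [(t * (m * _))%N]mulnC exprM h2 -exprM [(_ * t)%N]mulnC.
have -> : X ^+ (2 + (2 * t + 1) * p.-1)
    = X ^+ 2 * X ^+ ((2 * t + 1) * m) * X ^+ ((2 * t + 1) * n).
  by rewrite -!exprD; congr (X ^+ _); rewrite -{1}nm; lia.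
have h3 : q ^+ (2 * n).+1 * q ^+ (2 * m).+1 = 1.
  rewrite -exprD; have -> : ((2 * n).+1 + (2 * m).+1 = p * 2)%N by lia.
  by rewrite exprM (prim_expr_order q_prim) expr1n.
transitivity ((-1) ^+ n * q ^+ 'C(n, 2) * q ^+ (t * (n * (n + 1)))
   * (X^-1 ^+ ((2 * t + 1) * m) * X ^+ ((2 * t + 1) * m)) * X ^+ ((2 * t + 1) * n)
   * (q ^+ (2 * n).+1 * X ^+ 2 - q ^+ (2 * n).+1 * q ^+ (2 * m).+1 * (X^-1 ^+ 2 * X ^+ 2))).
  by ring.
by rewrite h3 -!exprMn mulVf // !expr1n; ring.
Qed.

End RootOfUnity.

(** * The formula as a Laurent polynomial *)

(** The quotient is identified in F[X], where 1 - 'X and the q-factorials are nonzero: [qbin] at 'X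
    satisfies the factorial relation there, and its recursion commutes with evaluation at q. *)
Lemma qbinom_horner (F : fieldType) (q : F) n k : (k <= n)%N ->
  (qbinom F n k).[q] = qbin q n k.
Proof.
move=> kn; have X1 : (1 - 'X : {poly F}) != 0.
  by rewrite -opprB oppr_eq0 polyXsubC_eq0.
have qintE m : qint F m * (1 - 'X) = 1 - 'X^m.
  rewrite /qint divpK // -[X in X %| _]opprB -[X in _ %| X]opprB.
  by rewrite dvdpNl dvdpNr subrX1 dvdp_mulr.
have qfactE m : qfact F m * (1 - 'X) ^+ m = qpoch 'X 'X m.
  elim: m => [|m IH]; first by rewrite /qfact big_nil qpoch0 mulr1.
  rewrite /qfact big_nat_recr //= qpoch_recr -IH exprSr mulrACA qintE.
  by rewrite -exprS.
have fact_neq0 m : qfact F m != 0.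
  rewrite /qfact prodf_seq_neq0; apply/allP => i; rewrite mem_index_iota => /andP [i0 _].
  apply/implyP => _; apply/eqP => h; have := qintE i; rewrite h mul0r => /eqP.
  by rewrite eq_sym subr_eq0 => /eqP /(congr1 (fun P : {poly F} => size P));
    rewrite size_polyXn size_poly1 => -[i1]; rewrite -i1 in i0.
have hornerX : (qbin 'X n k).[q] = qbin q n k.
  elim: n k {kn} => [|n IH] [|k]; try by rewrite !qbin0 hornerE.
    by rewrite !qbin_small // hornerE.
  by rewrite !qbinSr !hornerE !IH.
rewrite -hornerX /qbinom.
suff -> : qfact F n = qbin 'X n k * (qfact F k * qfact F (n - k)).
  by rewrite mulpK // mulf_neq0.
apply: (mulIf (expf_neq0 n X1)); rewrite qfactE -{1 2}(subnK kn) -qbin_fact -!qfactE.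
by rewrite subnK // -{6}(subnKC kn) exprD; ring.
Qed.

(** * Sums over chains of indices *)

Section ChainSum.
Variables (K : comNzRingType) (p : nat) (M : nat -> nat -> K).

(** A transfer-matrix argument: the induction sums out the smallest entry k_1, which replaces h by
    the function b |-> \sum_(j <= b) M b j h j. *)
Lemma chain_sum t (h phi : nat -> K) :
  \sum_(k : t.+1.-tuple 'I_p | sorted leq (map val k))
     h (nth 0%N (map val k) 0) * phi (nth 0%N (map val k) t)
     * \prod_(i < t) M (nth 0%N (map val k) i.+1) (nth 0%N (map val k) i)
  = \sum_(b < p) iter t (fun h b => \sum_(j < b.+1) M b j * h j) h b * phi b.
Proof.
have cons_sum s (P : pred (s.+1.-tuple 'I_p)) (f : s.+1.-tuple 'I_p -> K) :
    \sum_(k | P k) f k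
    = \sum_(k : s.-tuple 'I_p) \sum_(i : 'I_p | P [tuple of i :: k]) f [tuple of i :: k].
  rewrite pair_big_dep /= (reindex (fun x : s.-tuple 'I_p * 'I_p => [tuple of x.2 :: x.1])) //.
  exists (fun k : s.+1.-tuple 'I_p => ([tuple of behead k] : s.-tuple 'I_p, thead k))
      => [[k i]|k] _ /=.
    by congr (_, _); apply: val_inj.
  by rewrite -tuple_eta.
elim: t h => [|t IH] h.
  rewrite cons_sum (bigD1 [tuple]) //= [X in _ + X]big1 ?addr0 => [|k]; last first.
    by move=> /eqP []; exact: tuple0.
  by apply: eq_bigr => i _; rewrite big_ord0 mulr1.
rewrite iterSr -IH cons_sum [in RHS]big_mkcond; apply: eq_bigr => k _.
have [i0 [k' ek]] : exists (i0 : 'I_p) (k' : t.-tuple 'I_p), k = [tuple of i0 :: k'].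
  by exists (thead k), [tuple of behead k]; rewrite -tuple_eta.
rewrite {k}ek /=; case: ifP => sk; last first.
  by rewrite big_pred0 // => i; rewrite andbF.
rewrite [in RHS](big_ord_widen p (fun j => M i0 j * h j)) // !mulr_suml.
apply: eq_big => [i|i _]; first by rewrite andbT ltnS.
by rewrite big_ord_recl /=; ring.
Qed.
End ChainSum.

(** Only j = 0 survives the unit pair, so [bailey q X t] carries t - 1 genuine summations, as many
    as the product in the theorem has factors. *)
Lemma bailey1 (K : fieldType) (q X : K) b : bailey q X 1 b = 1.
Proof.
by rewrite /= big_ord_recl /= big1 ?addr0 => [|i _];
  rewrite ?mulr0 // qbin0 !muln0 !expr0 !mulr1.
Qed.

(** B is abstract because in C(x) the q-binomials occur as constants obtained by evaluating
    polynomials, identified with [qbin] for k <= n; sortedness of the tuple guarantees that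
    range. *)
Lemma torus_sum (K : fieldType) (q x : K) (B : nat -> nat -> K) p t :
  (0 < t)%N -> (forall n k, (k <= n)%N -> B n k = qbin q n k) ->
  \sum_(k : t.-tuple 'I_p | sorted leq (map val k))
    (let K i := nth 0%N (map val k) i.-1 in
    qpoch (x * q) q (K t) * x ^+ K t *
    \prod_(1 <= i < t)
      (q ^+ (K i * (K i + 1)) * x ^+ (2 * K i) * B (K i.+1) (K i)))
  = torus_poly q p x t.
Proof.
case: t => // t _ BE.
have betaS b : iter t (fun (h : nat -> K) (b : nat) => \sum_(j < b.+1)
    qbin q b j * q ^+ (j * (j + 1)) * x ^+ (2 * j) * h j) (bailey q x 1) b
    = bailey q x t.+1 b.
  elim: t b => // t IH b; apply: eq_bigr => j _; congr (_ * _); exact: IH.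
transitivity (\sum_(b < p) bailey q x t.+1 b * (qpoch (q * x) q b * x ^+ b)); last first.
  by apply: eq_bigr => b _; rewrite mulrC.
under [RHS]eq_bigr => b _ do rewrite -betaS.
rewrite -(@chain_sum K p (fun b j => qbin q b j * q ^+ (j * (j + 1)) * x ^+ (2 * j)) t _
  (fun b => qpoch (q * x) q b * x ^+ b)).
apply: eq_bigr => k sk; rewrite bailey1 mul1r /= [x * q]mulrC big_add1 big_mkord.
congr (_ * _); apply: eq_bigr => i _ /=; rewrite BE; first by ring.
by move/(sortedP 0%N): sk; apply; rewrite size_map size_tuple ltnS.
Qed.

(** * Powers of v and q *)

Section Exponents.
Variable R : realType.

Lemma vpow2 p (z : R[i]) : vpow p (2%:R * z) = epow p z.
Proof. by rewrite /vpow /epow; congr Cexp; ring. Qed.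

Lemma vpowX p (z : R[i]) n : vpow p (n%:R * z) = vpow p z ^+ n.
Proof.
elim: n => [|n IH]; first by rewrite mul0r vpow0 expr0.
by rewrite -natr1 mulrDl mul1r vpowD IH exprSr.
Qed.

Lemma vpow_p p : (0 < p)%N -> vpow p p%:R = -1 :> R[i].
Proof.
move=> p0; have pn0 : p%:R != 0 :> R[i] by rewrite pnatr_eq0 -lt0n.
have Ci : pi%:C * 'i = 0 +i* pi :> R[i] by simpc.
by rewrite /vpow mulfK // Ci /Cexp /= expR0 cospi sinpi mulr0 mul1r; simpc.
Qed.

(** {n} = 2 i sin(pi n / p), and pi n / p lies strictly between 0 and pi. *)
Lemma brace_neq0 p n : (0 < n < p)%N -> brace p n%:R != 0 :> R[i].
Proof.
move=> /andP [n0 np]; have p0 : (0 < p)%N by apply: leq_trans np.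
have pR : 0 < p%:R :> R by rewrite ltr0n.
pose th : R := pi * (n%:R / p%:R).
have eth : pi%:C * 'i * n%:R / p%:R = 0 +i* th :> R[i].
  rewrite -(rmorph_nat (real_complex R) p) -(rmorph_nat (real_complex R) n) -fmorphV.
  by simpc; congr (_ +i* _); rewrite /th mulrA.
rewrite /brace /vpow mulrN mulNr eth /Cexp /= oppr0 expR0 !mul1r cosN sinN.
rewrite subr_eq0; apply/eqP => -[] /eqP; rewrite -subr_eq0 opprK -mulr2n mulrn_eq0 /=.
rewrite gt_eqF // sin_gt0_pi // /th mulr_gt0 ?pi_gt0 ?divr_gt0 ?ltr0n //=.
by rewrite -[ltRHS]mulr1 ltr_pM2l ?pi_gt0 // ltr_pdivrMr // mul1r ltr_nat.
Qed.

Lemma brace_fact_neq0 p n : (n < p)%N -> brace_fact R p n != 0.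
Proof.
move=> np; rewrite /brace_fact big_nat_cond prodf_seq_neq0; apply/allP => i _.
by apply/implyP; rewrite andbT => /andP [i0 iN]; apply: brace_neq0; lia.
Qed.

(** As q^n = v^(2n), the equation q^n = 1 means v^n = v^-n, that is {n} = 0. *)
Lemma epow_prim p : (0 < p)%N -> p.-primitive_root (epow p 1 : R[i]).
Proof.
move=> p0; rewrite /primitive_root_of_unity p0 /=; apply/forallP => i.
rewrite unity_rootE -vpow2 mulr1 -vpowX mulrC vpowX.
have [->|ip] := eqVneq i.+1 p; first by rewrite vpow_p // sqrrN expr1n eqxx.
have /brace_neq0 : (0 < i.+1 < p)%N by rewrite /= ltn_neqAle ip ltn_ord.
rewrite /brace vpowN; have := vpow_neq0 p (i.+1%:R : R[i]).
move: (vpow p _) => v v0 h; rewrite eqbF_neg; apply: contra h => /eqP h.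
by rewrite -[v^-1]mul1r -h expr2 mulfK // subrr.
Qed.

End Exponents.

Lemma rmorph_qbin (A B : comNzRingType) (f : {rmorphism A -> B}) q n k :
  f (qbin q n k) = qbin (f q) n k.
Proof.
elim: n k => [|n IH] [|k]; rewrite ?qbin0 ?rmorph1 //.
  by rewrite !qbin_small ?rmorph0.
by rewrite !qbinSr rmorphD rmorphM rmorphXn !IH.
Qed.

Lemma rmorph_qpoch (A B : comNzRingType) (f : {rmorphism A -> B}) a q n :
  f (qpoch a q n) = qpoch (f a) (f q) n.
Proof.
rewrite rmorph_prod; apply: eq_bigr => i _.
by rewrite rmorphB rmorph1 rmorphM rmorphXn.
Qed.

Lemma rmorph_torus_poly (A B : comNzRingType) (f : {rmorphism A -> B}) q p X t :
  f (torus_poly q p X t) = torus_poly (f q) p (f X) t.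
Proof.
have fbeta b : f (bailey q X t b) = bailey (f q) (f X) t b.
  elim: t b => [|t IH] b; first by rewrite /= rmorph_nat.
  rewrite rmorph_sum; apply: eq_bigr => j _.
  by rewrite !rmorphM !rmorphXn rmorph_qbin; congr (_ * _); exact: IH.
rewrite rmorph_sum; apply: eq_bigr => b _.
by rewrite !rmorphM rmorphXn rmorph_qpoch fbeta rmorphM.
Qed.

(* The value at 'X^-1, uniformly over all specialisations of 'X. *)
Lemma torus_poly_inv_poly (F : fieldType) (q : F) p t :
  exists (P : {poly F}) (s : nat), forall (K : fieldType) (f : {rmorphism {poly F} -> K}),
    f 'X != 0 -> f P = torus_poly (f q%:P) p (f 'X)^-1 t * f 'X ^+ s.
Proof.
pose G := torus_poly q%:P p 'X t; pose s := size G.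
(* P is the coefficient reversal X^s G(1/X). The map f will be both the embedding in C(x) and the
   evaluation at a complex number. *)
exists (\sum_(i < s) (G`_i)%:P * 'X^(s - i)), s => K f fX.
pose g := f \o polyC.
have cg : commr_rmorph g (f 'X)^-1 by move=> c; exact: mulrC.
have -> : torus_poly (f q%:P) p (f 'X)^-1 t = horner_morph cg G.
  by rewrite rmorph_torus_poly /= horner_morphC horner_morphX.
have -> : horner_morph cg G = \sum_(i < s) g G`_i * (f 'X)^-1 ^+ i.
  have eG : G = \sum_(i < s) (G`_i)%:P * 'X^i.
    by rewrite -[LHS]coefK poly_def; apply: eq_bigr => i _; rewrite mul_polyC.
  rewrite [in LHS]eG rmorph_sum; apply: eq_bigr => i _.
  by rewrite rmorphM rmorphXn /= horner_morphC horner_morphX.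
rewrite rmorph_sum mulr_suml; apply: eq_bigr => i _; rewrite rmorphM rmorphXn.
have -> : f 'X ^+ s = f 'X ^+ i * f 'X ^+ (s - i).
  by rewrite -exprD subnKC // ltnW.
by rewrite -mulrA; congr (_ * _); rewrite mulrA -exprMn mulVf // expr1n mul1r.
Qed.

Lemma torus_poly_p1 (K : comNzRingType) (q X : K) t : torus_poly q 1 X t = 1.
Proof.
rewrite /torus_poly big_ord1 qpoch0 !mul1r.
elim: t => // t IH; rewrite /= big_ord1 qbin0 mul0n muln0 !expr0 !mul1r; exact: IH.
Qed.

Section TorusFormula.
Variables (R : realType) (t p : nat).
Hypotheses (t_gt0 : (0 < t)%N) (p_gt0 : (0 < p)%N).
Let q : R[i] := epow p 1.
Let x : {fraction {poly R[i]}} := tofrac 'X.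
Let cst (c : R[i]) : {fraction {poly R[i]}} := tofrac c%:P.

Let x0 : x != 0. Proof. by rewrite tofrac_eq0 polyX_eq0. Qed.

Lemma torus_formula_torus_poly : torus_formula R t p
  = cst (q ^+ t) * x ^ (t%:Z * (1 - p%:Z)) * torus_poly (cst q) p x t.
Proof.
rewrite /torus_formula; congr (_ * _).
rewrite -(@torus_sum _ (cst q) x (fun n k => cst (qbinom R[i] n k).[q]) p t) //; last first.
  move=> n k kn; rewrite qbinom_horner //.
  exact: (rmorph_qbin (@tofrac {poly R[i]} \o polyC)).
apply: eq_bigr => k _ /=; congr (_ * _); apply: eq_bigr => i _.
by congr (_ * _ * _); rewrite /cst !rmorphXn.
Qed.

(** The value at y has the shape that the tangle produces. In C(x) the factor x^(2t(p-1)) of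
    [torus_poly_inv] turns the prefactor x^(-t(p-1)) into x^(t(p-1)). *)
Lemma torus_formula_poly : exists (P : {poly R[i]}) (n : nat),
  torus_formula R t p = tofrac P / tofrac 'X^n /\
  forall y : R[i], y != 0 ->
    P.[y] / y ^+ n = q ^+ t * y ^+ (t * p.-1) * torus_poly q p y^-1 t.
Proof.
have [P [s HP]] := torus_poly_inv_poly q p t.
exists (q ^+ t *: ('X^(t * p.-1) * P)), s; split; last first.
  move=> y y0; rewrite hornerZ !hornerE.
  have := HP _ (horner_eval y); rewrite /= /horner_eval !hornerE => -> //.
  by rewrite -!mulrA divff ?expf_neq0 // mulr1.
have cqP : p.-primitive_root (cst q).
  by rewrite (fmorph_primitive_root (@tofrac {poly R[i]} \o polyC)) epow_prim.
have xg : x ^+ (2 * p) != 1.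
  rewrite -tofracXn -tofrac1 tofrac_eq; apply/eqP => /(congr1 (fun P : {poly _} => size P)).
  by rewrite size_polyXn size_poly1 => -[]; lia.
rewrite torus_formula_torus_poly -(torus_poly_inv cqP t x0 xg).
have -> : x ^ (t%:Z * (1 - p%:Z)) = (x ^+ (t * p.-1))^-1.
  have -> : 1 - p%:Z = - (p.-1)%:Z by lia.
  by rewrite mulrN -PoszM -exprnN.
have hP : tofrac P = torus_poly (cst q) p x^-1 t * x ^+ s.
  exact: HP _ (@tofrac {poly R[i]}) x0.
rewrite -mul_polyC !tofracM hP tofracXn -/x.
have -> : (2 * t * p.-1 = t * p.-1 + t * p.-1)%N by lia.
rewrite tofracXn exprD -/x -[tofrac (_ ^+ t)%:P]/(cst (q ^+ t)).
have alg (K : fieldType) (a y g z : K) : y != 0 -> z != 0 ->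
    a / y * (g * (y * y)) = a * (y * (g * z)) / z.
  by move=> y0 z0; field; rewrite ?y0 ?z0.
have xm := expf_neq0 (t * p.-1) x0; have xs := expf_neq0 s x0.
exact: alg xm xs.
Qed.

Lemma torus_formula1 : p = 1%N -> torus_formula R t p = 1.
Proof.
move=> p1; rewrite torus_formula_torus_poly p1 torus_poly_p1 mulr1 subrr mulr0 mulr1.
have -> : q = 1 by rewrite -(prim_expr_order (epow_prim R p_gt0)) -/q [X in q ^+ X]p1.
by rewrite expr1n /cst tofrac1.
Qed.
End TorusFormula.

(** * The braiding, its closures and the tangle *)

Lemma tensmxDl (A : pzRingType) m n p q (X Y : 'M[A]_(m, n)) (Z : 'M[A]_(p, q)) :
  (X + Y) *t Z = X *t Z + Y *t Z.
Proof. by apply/matrixP => i j; rewrite !mxE mulrDl. Qed.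

Lemma tensmxN (A : pzRingType) m n p q (X : 'M[A]_(m, n)) (Z : 'M[A]_(p, q)) :
  (- X) *t Z = - (X *t Z).
Proof. by apply/matrixP => i j; rewrite !mxE mulNr. Qed.

Lemma tensmxZ (A : pzRingType) m n p q (X : 'M[A]_(m, n)) (Z : 'M[A]_(p, q)) x :
  (x *: X) *t Z = x *: (X *t Z).
Proof. by apply/matrixP => i j; rewrite !mxE mulrA. Qed.

(** U is a flux from b to b + 1: what leaves one index enters the next, and nothing leaves the
    last. *)
Lemma telescope_sum (V : zmodType) n (f g U : nat -> V) :
  (forall b, (b < n)%N -> f b + U b = g b + (if b is b'.+1 then U b' else 0)) ->
  (forall m, n = m.+1 -> U m = 0) -> \sum_(b < n) f b = \sum_(b < n) g b.
Proof.
move=> e U0; apply: (addIr (\sum_(b < n) U b)); rewrite -big_split /=.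
rewrite (eq_bigr _ (fun (b : 'I_n) _ => e b (ltn_ord b))) big_split /=; congr (_ + _).
case: n U0 {e} => [|m] U0; first by rewrite !big_ord0.
rewrite big_ord_recl [RHS]big_ord_recr /= U0 // addr0 add0r.
by apply: eq_bigr.
Qed.

Lemma locally_constant (A : Type) (f : nat -> A) n :
  (forall a, (a.+1 < n)%N -> f a.+1 = f a) -> forall a, (a < n)%N -> f a = f 0%N.
Proof. by move=> h; elim=> // a IH an; rewrite h // IH // ltnW. Qed.

Lemma expmxS_mul (A : pzRingType) n m (X : 'M[A]_n) (u : 'cV[A]_n) :
  X ^+ m.+1 *m u = X *m (X ^+ m *m u).
Proof. by rewrite exprS -mulmxE -mulmxA. Qed.

Lemma expmxSr_mul (A : pzRingType) n m (X : 'M[A]_n) (u : 'cV[A]_n) :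
  X ^+ m.+1 *m u = X ^+ m *m (X *m u).
Proof. by rewrite exprSr -mulmxE -mulmxA. Qed.

Lemma big_tuple_cons (V : nmodType) (T : finType) s (f : seq T -> V) :
  \sum_(k : s.+1.-tuple T) f k = \sum_(i : T) \sum_(k : s.-tuple T) f (i :: k).
Proof.
rewrite pair_big /= (reindex (fun x : T * s.-tuple T => [tuple of x.1 :: x.2])) //.
exists (fun k : s.+1.-tuple T => (thead k, [tuple of behead k] : s.-tuple T))
    => [[i k]|k] _ /=.
  by congr (_, _); apply: val_inj.
by rewrite -tuple_eta.
Qed.

Lemma big_tuple0 (V : nmodType) (T : finType) (f : seq T -> V) :
  \sum_(k : 0.-tuple T) f k = f [::].
Proof.
rewrite (bigD1 [tuple]) //= big1 ?addr0 // => k /eqP [].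
exact: tuple0.
Qed.

(** * The functor on powers and closures of tangles *)

Section Functor.
Variables (R : realType) (p : nat) (lam : R[i]).
Notation C := R[i].

Lemma RT_tpow_pos n (b1 b2 a1 a2 : 'I_p) :
  RT lam (tpow tpos n) [:: b1; b2] [:: a1; a2]
  = (braiding p lam ^+ n) (mxtens_index (b1, b2)) (mxtens_index (a1, a2)).
Proof.
elim: n a1 a2 b1 b2 => [|n IH] a1 a2 b1 b2.
  rewrite expr0 mxE (can_eq (@mxtens_indexK p p)) /= xpair_eqE eqseq_cons.
  by rewrite eqseq_cons andbT.
rewrite exprS -mulmxE mxE.
(* The summand is restated as a function of the underlying sequence, the form that [big_tuple_cons]
   expects. *)
transitivity (\sum_(k : 2.-tuple 'I_p) (fun k : seq 'I_p => RT lam tpos [:: b1; b2] k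
   * RT lam (tpow tpos n) k [:: a1; a2]) k); first by [].
rewrite (@big_tuple_cons _ _ _ (fun k : seq 'I_p => RT lam tpos [:: b1; b2] k
   * RT lam (tpow tpos n) k [:: a1; a2])).
rewrite [RHS](reindex (@mxtens_index p p)); last first.
  by exists (@mxtens_unindex p p) => x _; rewrite ?mxtens_indexK ?mxtens_unindexK.
transitivity (\sum_i \sum_j braiding p lam (mxtens_index (b1, b2)) (mxtens_index (i, j))
  * (braiding p lam ^+ n) (mxtens_index (i, j)) (mxtens_index (a1, a2))); last first.
  by rewrite pair_bigA; apply: eq_bigr => -[i j] _.
apply: eq_bigr => i _.
rewrite (@big_tuple_cons _ _ _ (fun k : seq 'I_p => RT lam tpos [:: b1; b2] (i :: k)
   * RT lam (tpow tpos n) (i :: k) [:: a1; a2])).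
apply: eq_bigr => j _; rewrite (@big_tuple0 _ _ (fun k : seq 'I_p => RT lam tpos [:: b1; b2]
  [:: i, j & k] * RT lam (tpow tpos n) [:: i, j & k] [:: a1; a2])).
by rewrite IH.
Qed.

Lemma big_delta (V : comNzRingType) (T : finType) (i : T) (f : T -> V) :
  \sum_j (i == j)%:R * f j = f i.
Proof.
rewrite (bigD1 i) //= eqxx mul1r big1 ?addr0 // => j; rewrite eq_sym => /negPf ->.
by rewrite mul0r.
Qed.

Lemma big_tuple3 (V : nmodType) (T : finType) (f : seq T -> V) :
  \sum_(k : 3.-tuple T) f k = \sum_i \sum_j \sum_l f [:: i; j; l].
Proof.
rewrite big_tuple_cons; apply: eq_bigr => i _.
rewrite (@big_tuple_cons _ _ _ (fun k => f (i :: k))); apply: eq_bigr => j _.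
rewrite (@big_tuple_cons _ _ _ (fun k => f [:: i, j & k])); apply: eq_bigr => l _.
exact: (@big_tuple0 _ _ (fun k => f [:: i, j, l & k])).
Qed.

Lemma RT_right_closure (T : tangle [:: Up; Up] [:: Up; Up]) (i j : 'I_p) :
  RT lam (right_closure T) [:: i] [:: j]
  = \sum_(b < p) pivot lam b * RT lam T [:: i; b] [:: j; b].
Proof.
pose g (k : seq 'I_p) : C := \sum_(l : 3.-tuple 'I_p)
  (RT lam T (take 2 k) (take 2 l) * (drop 2 k == drop 2 l)%:R)
  * ((take 1 l == [:: j])%:R * RT lam (p := p) tcoev (drop 1 l) [::]).
pose f (k : seq 'I_p) : C := ([:: i] == take 1 k)%:R * RT lam (p := p) tevr [::] (drop 1 k)
  * g k.
transitivity (\sum_(k : 3.-tuple 'I_p) f k); first by [].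
rewrite big_tuple3.
have gE k1 k2 k3 : g [:: k1; k2; k3] = RT lam T [:: k1; k2] [:: j; k3].
  rewrite /g (@big_tuple3 _ _ (fun l : seq 'I_p =>
    (RT lam T (take 2 [:: k1; k2; k3]) (take 2 l) * (drop 2 [:: k1; k2; k3] == drop 2 l)%:R)
    * ((take 1 l == [:: j])%:R * RT lam (p := p) tcoev (drop 1 l) [::]))) /=.
  transitivity (\sum_a (j == a)%:R * \sum_b (k3 == b)%:R * RT lam T [:: k1; k2] [:: a; b]).
    apply: eq_bigr => a _; rewrite mulr_sumr; apply: eq_bigr => b _.
    transitivity (\sum_d (k3 == d)%:R * ((j == a)%:R * (b == d)%:R
        * RT lam T [:: k1; k2] [:: a; b])).
      apply: eq_bigr => d _; rewrite !eqseq_cons !andbT [j == a]eq_sym; ring.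
    by rewrite big_delta [b == k3]eq_sym; ring.
  by rewrite big_delta big_delta.
transitivity (\sum_a (i == a)%:R * \sum_b pivot lam b * RT lam T [:: a; b] [:: j; b]).
  apply: eq_bigr => a _; rewrite mulr_sumr; apply: eq_bigr => b _.
  transitivity (\sum_d (b == d)%:R * ((i == a)%:R * pivot lam b
      * RT lam T [:: a; b] [:: j; d])).
    by apply: eq_bigr => d _; rewrite /f gE /= !eqseq_cons !andbT; ring.
  by rewrite big_delta; ring.
by rewrite big_delta.
Qed.

Lemma RT_tpow_scalar (S : tangle [:: Up] [:: Up]) kappa n :
  (forall i j : 'I_p, RT lam S [:: i] [:: j] = kappa *+ (i == j)) ->
  forall i j : 'I_p, RT lam (tpow S n) [:: i] [:: j] = kappa ^+ n *+ (i == j).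
Proof.
move=> h; elim: n => [|n IH] i j; first by rewrite /= eqseq_cons andbT expr0.
pose f (k : seq 'I_p) : C := RT lam S [:: i] k * RT lam (tpow S n) k [:: j].
transitivity (\sum_(k : 1.-tuple 'I_p) f k); first by [].
rewrite big_tuple_cons.
transitivity (\sum_a (i == a)%:R * (kappa * (kappa ^+ n *+ (a == j)))).
  apply: eq_bigr => a _; rewrite (@big_tuple0 _ _ (fun k => f (a :: k))) /f h IH.
  by rewrite -[kappa *+ (i == a)]mulr_natr; ring.
by rewrite big_delta exprS mulrnAr.
Qed.
End Functor.

Lemma writhe_tpow s (T : tangle s s) n : writhe (tpow T n) = writhe T *+ n.
Proof. by elim: n => // n IH; rewrite [LHS]/= IH mulrS. Qed.

Lemma writhe_torus t : writhe (torus_tangle t) = 0.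
Proof.
have closure T : writhe (right_closure T) = writhe T by rewrite /= add0r !addr0.
by rewrite [LHS]/= !addr0 add0r !writhe_tpow closure /= mulNrn subrr.
Qed.

(** * The braiding on the basis vectors of V (x) V *)

Section Representation.
Variables (R : realType) (p : nat) (lam : R[i]).
Hypothesis p_gt0 : (0 < p)%N.
Local Notation C := R[i].
Local Notation E := (Emx p lam).
Local Notation F := (Fmx R p).
Local Notation c := (braiding p lam).
Local Notation q := (epow p (1 : C)).
Local Notation z := (vpow p (- (2%:R * lam))).
Local Notation x := (epow p (lam + 1)).

Let q_prim : p.-primitive_root q := epow_prim R p_gt0.

(* zero for k >= p *)
Definition ev k : 'cV[C]_p := \col_(i < p) ((i : nat) == k)%:R.
Definition tens (u w : 'cV[C]_p) : 'cV[C]_(p * p) := u *t w.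
Definition ket a b := tens (ev a) (ev b).
Definition ent (X : 'M[C]_(p * p)) a b c d : C := ((ket a b)^T *m (X *m ket c d)) 0 0.

Lemma ev_out k : (p <= k)%N -> ev k = 0.
Proof.
by move=> pk; apply/matrixP => i j; rewrite !mxE ltn_eqF // (leq_trans (ltn_ord i)).
Qed.

Lemma tens_mul (A B : 'M[C]_p) u w : (A *t B) *m tens u w = tens (A *m u) (B *m w).
Proof. exact: (@tensmx_mul C p p p p 1 1 A B u w). Qed.

Lemma tensE u w (i j : 'I_p) : tens u w (mxtens_index (i, j)) 0 = u i 0 * w j 0.
Proof. by rewrite /tens mxE mxtens_indexK /= !ord1. Qed.

Lemma tens_ext (u w : 'cV[C]_(p * p)) :
  (forall i j : 'I_p, u (mxtens_index (i, j)) 0 = w (mxtens_index (i, j)) 0) -> u = w.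
Proof.
move=> h; apply/matrixP => k l; rewrite ord1; case: (mxtens_indexP k) => i j.
exact: h.
Qed.

Lemma tensZ x y u w : tens (x *: u) (y *: w) = (x * y) *: tens u w.
Proof. by apply: tens_ext => i j; rewrite tensE [RHS]mxE tensE !mxE; ring. Qed.

Lemma ket_outl a b : (p <= a)%N -> ket a b = 0.
Proof.
move=> pa; rewrite /ket ev_out //.
by apply: tens_ext => i j; rewrite tensE !mxE mul0r.
Qed.

Lemma ket_outr a b : (p <= b)%N -> ket a b = 0.
Proof.
move=> pb; rewrite /ket (@ev_out b) //.
by apply: tens_ext => i j; rewrite tensE !mxE mulr0.
Qed.

Lemma ket_delta (i j : 'I_p) : ket i j = delta_mx (mxtens_index (i, j)) 0.
Proof.
apply: tens_ext => k l; rewrite tensE !mxE eqxx andbT (can_eq (@mxtens_indexK p p)).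
by rewrite xpair_eqE -natrM mulnb -!val_eqE.
Qed.

Lemma entE X (i j k l : 'I_p) :
  ent X i j k l = X (mxtens_index (i, j)) (mxtens_index (k, l)).
Proof. by rewrite /ent !ket_delta trmx_delta -colE -rowE !mxE. Qed.

Lemma ket_eq (X Y : 'M[C]_(p * p)) :
  (forall a b, (a < p)%N -> (b < p)%N -> X *m ket a b = Y *m ket a b) -> X = Y.
Proof.
move=> h; apply/matrixP => k l.
case: (mxtens_indexP k) => a b; case: (mxtens_indexP l) => c d.
by rewrite -!entE /ent h.
Qed.

Lemma ev_eq (X Y : 'M[C]_p) :
  (forall a, (a < p)%N -> X *m ev a = Y *m ev a) -> X = Y.
Proof.
have evd (i : 'I_p) : ev i = delta_mx i 0.
  by apply/matrixP => k l; rewrite !mxE ord1 eqxx andbT.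
move=> h; apply/matrixP => k l; have := h l (ltn_ord l).
by rewrite evd -!colE => /matrixP /(_ k 0); rewrite !mxE.
Qed.

Lemma ket_col (u : 'cV[C]_(p * p)) (i j : 'I_p) :
  ((ket i j)^T *m u) 0 0 = u (mxtens_index (i, j)) 0.
Proof. by rewrite ket_delta trmx_delta -rowE mxE. Qed.

Lemma ket_dot (a b c d : nat) : (a < p)%N -> (b < p)%N ->
  ((ket a b)^T *m ket c d) 0 0 = ((a == c) && (b == d))%:R.
Proof.
move=> ap bp; rewrite (ket_col _ (Ordinal ap) (Ordinal bp)) tensE !mxE /=.
by rewrite -natrM mulnb.
Qed.

Lemma diag_ev (d : nat -> C) k : diag_mx (\row_i d i) *m ev k = d k *: ev k.
Proof.
apply/matrixP => i j; rewrite mul_diag_mx !mxE.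
by case: eqP => [->|_]; rewrite ?mulr1 ?mulr0.
Qed.

Definition wtn (k : nat) : C := lam - 2%:R * k%:R.
Definition Ecoef (k : nat) : C :=
  brace p k%:R / brace p 1 * (brace p (lam + 1 - k%:R) / brace p 1).
Definition En_coef a n : C := \prod_(i < n) Ecoef (a - i).
Definition R_coef n : C :=
  brace p 1 ^+ (2 * n) / brace_fact R p n * vpow p (n%:R * (n%:R - 1) / 2%:R).

Lemma F_ev k : F *m ev k = ev k.+1.
Proof.
have [kp|pk] := ltnP k p; last by rewrite !ev_out ?mulmx0 // leqW.
apply/matrixP => i j; rewrite !mxE (bigD1 (Ordinal kp)) //= !mxE /= eqxx mulr1.
rewrite big1 ?addr0 // => l; rewrite -val_eqE /= => lk; rewrite !mxE.
by rewrite (negbTE lk) mulr0.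
Qed.

Lemma Fn_ev n k : F ^+ n *m ev k = ev (k + n)%N.
Proof.
elim: n k => [|n IH] k; first by rewrite expr0 mul1mx addn0.
by rewrite exprSr -mulmxE -mulmxA F_ev IH addSnnS.
Qed.

Lemma E_ev k : (k < p)%N -> E *m ev k = Ecoef k *: ev k.-1.
Proof.
move=> kp; apply/matrixP => i j; rewrite !mxE (bigD1 (Ordinal kp)) //= big1 ?addr0.
  rewrite !mxE /= eqxx mulr1; case: k kp => [|k] kp /=.
    by rewrite /Ecoef brace0 !mul0r.
  by rewrite eqSS; case: eqP; rewrite ?mulr1 ?mulr0.
move=> l; rewrite -val_eqE /= => lk; rewrite !mxE.
by rewrite (negbTE lk) mulr0.
Qed.

Lemma En_ev n k : (k < p)%N -> E ^+ n *m ev k = En_coef k n *: ev (k - n)%N.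
Proof.
move=> kp; elim: n => [|n IH].
  by rewrite expr0 mul1mx /En_coef big_ord0 scale1r subn0.
rewrite exprS -mulmxE -mulmxA IH -scalemxAr E_ev; last by lia.
by rewrite scalerA /En_coef big_ord_recr /= subnS.
Qed.

(** The truncated difference a - i reaches 0 within the product, and [Ecoef 0] vanishes. *)
Lemma En_coef_out a n : (a < n)%N -> En_coef a n = 0.
Proof.
move=> an; rewrite /En_coef (bigD1 (Ordinal an)) //= subnn.
by rewrite /Ecoef brace0 !mul0r.
Qed.

Lemma vHH_ket a b :
  vHH p lam *m ket a b = vpow p (wtn a * wtn b / 2%:R) *: ket a b.
Proof.
apply: tens_ext => i j; rewrite mul_diag_mx !mxE !mxtens_indexK /= /wt.
by case: eqP => [->|_]; rewrite ?mul0r ?mulr0 //; case: eqP => [->|_]; rewrite ?mulr0.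
Qed.

Lemma flip_tens u w : flip R p *m tens u w = tens w u.
Proof.
apply: tens_ext => i j; rewrite tensE mxE (bigD1 (mxtens_index (j, i))) //=.
rewrite tensE !mxE !mxtens_indexK /= !eqxx mul1r big1 ?addr0 1?mulrC // => k.
case: (mxtens_indexP k) => a b; rewrite (can_eq (@mxtens_indexK p p)) => ne.
rewrite !mxE !mxtens_indexK /=; case: eqP => [ib|]; last by rewrite mul0r.
case: eqP => [ja|]; last by rewrite mul0r.
by rewrite ib ja eqxx in ne.
Qed.

Lemma braiding_ket a b : (a < p)%N ->
  c *m ket a b = \sum_(n < p) (R_coef n * En_coef a n
    * vpow p (wtn (a - n) * wtn (b + n) / 2%:R)) *: ket (b + n)%N (a - n)%N.
Proof.
move=> ap; rewrite /braiding /Rmx -!mulmxA mulmx_suml !mulmx_sumr.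
apply: eq_bigr => n _; rewrite -scalemxAl tens_mul En_ev // Fn_ev.
rewrite -[ev (b + n)%N]scale1r tensZ mulr1 -!scalemxAr vHH_ket -scalemxAr flip_tens.
by rewrite !scalerA -/(R_coef n); congr (_ *: _); ring.
Qed.

(** * Commutation of the braiding with the coproduct of F *)

Definition Kmx : 'M[C]_p := diag_mx (\row_(i < p) vpow p (wt lam i)).
Definition Kinv : 'M[C]_p := diag_mx (\row_(i < p) (vpow p (wt lam i))^-1).
Definition Delta_F : 'M[C]_(p * p) := Kinv *t F + F *t 1%:M.

Lemma K_ev k : Kmx *m ev k = vpow p (wtn k) *: ev k.
Proof. exact: (diag_ev (fun k => vpow p (wtn k))). Qed.

Lemma Kinv_ev k : Kinv *m ev k = (vpow p (wtn k))^-1 *: ev k.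
Proof. exact: (diag_ev (fun k => (vpow p (wtn k))^-1)). Qed.

Lemma Kinv_En n : Kinv *m E ^+ n = vpow p (- (2 * n)%:R) *: (E ^+ n *m Kinv).
Proof.
apply: ev_eq => k kp; rewrite -scalemxAl -!mulmxA Kinv_ev -scalemxAr !En_ev //.
rewrite -scalemxAr Kinv_ev !scalerA; congr (_ *: _).
have [kn|nk] := ltnP k n; first by rewrite En_coef_out //; ring.
have -> : wtn (k - n) = wtn k + (2 * n)%:R by rewrite /wtn natrB // natrM; ring.
by rewrite vpowD vpowN invfM; ring.
Qed.

(** This is v^(-n) {n+1} / {1}^2, written as the sum that the induction for [E^(n+1), F]
    produces. *)
Definition comm_coef n : C := (brace p 1)^-1 * \sum_(i < n.+1) vpow p (- (2 * i)%:R).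

Lemma comm_EnF n :
  E ^+ n.+1 *m F - F *m E ^+ n.+1 = comm_coef n *: (Kmx *m E ^+ n - E ^+ n *m Kinv).
Proof.
have [_ [hK _] hEF _ _] := weight_module_V lam p_gt0.
elim: n => [|n IH].
  rewrite expr1 expr0 mulmx1 mul1mx hEF /comm_coef big_ord1 muln0 oppr0 vpow0 mulr1.
  by [].
have -> : E ^+ n.+2 *m F - F *m E ^+ n.+2
   = E *m (E ^+ n.+1 *m F - F *m E ^+ n.+1) + (E *m F - F *m E) *m E ^+ n.+1.
  have -> : E ^+ n.+2 = E *m E ^+ n.+1 by rewrite exprS -mulmxE.
  by rewrite mulmxBr mulmxBl !mulmxA addrA addrNK.
rewrite IH hEF -scalemxAr mulmxBr -scalemxAl mulmxBl -/Kmx -/Kinv Kinv_En !mulmxA.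
have -> : E *m Kmx = vpow p (- 2%:R) *: (Kmx *m E).
  by rewrite hK scalerA -vpowD addNr vpow0 scale1r.
rewrite -scalemxAl -[Kmx *m E *m _]mulmxA !mulmxE -!exprS -!mulmxE.
rewrite !scalerBr !scalerA addrACA -scalerDl -opprD -scalerDl.
congr (_ *: _ - _ *: _); rewrite /comm_coef.
  rewrite [in RHS]big_ord_recl muln0 oppr0 vpow0 [RHS]mulrDr mulr1 addrC; congr (_ + _).
  rewrite -mulrA; congr (_ * _); rewrite mulr_suml; apply: eq_bigr => i _.
  by rewrite -vpowD lift0 mulnS natrD; congr vpow; ring.
by rewrite [in RHS]big_ord_recr mulrDr.
Qed.

Lemma brace_sum n :
  brace p (n.+1%:R : C) = brace p 1 * vpow p n%:R * \sum_(i < n.+1) vpow p (- (2 * i)%:R).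
Proof.
elim: n => [|n IH]; first by rewrite big_ord1 muln0 oppr0 vpow0 !mulr1.
rewrite big_ord_recr mulrDr.
have -> : brace p 1 * vpow p n.+1%:R * \sum_(i < n.+1) vpow p (- (2 * i)%:R)
    = vpow p 1 * brace p (n.+1%:R : C).
  by rewrite IH -[n.+1%:R]natr1 vpowD; ring.
have -> : brace p 1 * vpow p n.+1%:R * vpow p (- (2 * n.+1)%:R : C)
    = brace p 1 * vpow p (- n.+1%:R).
  by rewrite -mulrA -vpowD natrM; congr (_ * vpow p _); ring.
rewrite /brace mulrBr mulrBl -!vpowD addrA.
have -> : 1 + n.+1%:R = n.+2%:R :> C by rewrite -[n.+2%:R]natr1 addrC.
have -> : -1 - n.+1%:R = - n.+2%:R :> C by rewrite -[n.+2%:R]natr1 opprD addrC.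
by rewrite addrNK.
Qed.

(** The recursion that singles out the coefficients of the R-matrix: it makes consecutive terms
    cancel in [Theta_Delta_F]. *)
Lemma R_coef_comm n : (n.+1 < p)%N -> R_coef n.+1 * comm_coef n = R_coef n.
Proof.
move=> np; have b0 k : (0 < k < p)%N -> brace p (k%:R : C) != 0 by apply: brace_neq0.
have bf0 : brace_fact R p n != 0 by apply/brace_fact_neq0/ltnW.
have bn := b0 n.+1 np; have b1 : brace p (1 : C) != 0 by apply: (b0 1%N); lia.
rewrite /R_coef /comm_coef /brace_fact big_nat_recr //= -/(brace_fact R p n).
have -> : n.+1%:R * (n.+1%:R - 1) / 2%:R = n%:R * (n%:R - 1) / 2%:R + n%:R :> C.
  by rewrite -natr1; field.
rewrite vpowD mulnS exprD.
move: bn; rewrite brace_sum => bn.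
have s0 := bn; rewrite !mulf_eq0 !negb_or in s0; case/andP: s0 => _ s0.
by field; rewrite bf0 vpow_neq0 b1 s0.
Qed.

(* the quasi-R-matrix *)
Definition Theta : 'M[C]_(p * p) := \sum_(n < p) R_coef n *: (E ^+ n *t F ^+ n).

(** The n-th terms of the two sides differ by [a n - b n], and b n = a (n+1) by [comm_EnF] and
    [R_coef_comm]. The ends vanish: a 0 holds a trivial commutator and b (p-1) contains F^p. *)
Lemma Theta_Delta_F :
  Theta *m Delta_F = (F *t 1%:M + Kmx *t F) *m Theta.
Proof.
rewrite /Theta mulmx_suml mulmx_sumr.
apply/eqP; rewrite -subr_eq0 -sumrB; apply/eqP.
pose a n := R_coef n *: ((E ^+ n *m F - F *m E ^+ n) *t F ^+ n).
pose b n := R_coef n *: ((Kmx *m E ^+ n - E ^+ n *m Kinv) *t F ^+ n.+1).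
transitivity (\sum_(n < p) (a n - b n)).
  apply: eq_bigr => n _; rewrite /a /b /Delta_F -scalemxAl -scalemxAr -!scalerBr.
  rewrite mulmxDr mulmxDl !tensmx_mul mulmx1 mul1mx !tensmxDl !tensmxN.
  congr (_ *: _); rewrite !mulmxE -exprS -exprSr.
  rewrite !opprD opprK.
  by rewrite [LHS]addrC addrACA addrC [X in X + _]addrC addrACA.
rewrite sumrB; apply/eqP; rewrite subr_eq0; apply/eqP.
suff shift m : m.+1 = p -> \sum_(n < m.+1) a n = \sum_(n < m.+1) b n.
  by have := shift p.-1; rewrite prednK //; apply.
move=> mp; rewrite big_ord_recl [RHS]big_ord_recr /=.
have -> : a 0%N = 0.
  by rewrite /a expr0 mul1mx mulmx1 subrr tens0mx scaler0.
have -> : b m = 0.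
  by rewrite /b mp Fmx_nilp tensmx0 scaler0.
rewrite add0r addr0; apply: eq_bigr => n _; rewrite (_ : bump 0 n = n.+1) // /a /b.
have np : (n.+1 < p)%N by have := ltn_ord n; lia.
by rewrite comm_EnF tensmxZ scalerA R_coef_comm.
Qed.

(** Conjugation by v^(H (x) H / 2) turns F (x) 1 + K (x) F into F (x) K^-1 + 1 (x) F, which the flip
    turns back into Delta(F). *)
Lemma braiding_Delta_F : c *m Delta_F = Delta_F *m c.
Proof.
have v1 : vHH p lam *m (F *t 1%:M) = (F *t Kinv) *m vHH p lam.
  apply: ket_eq => a b ap bp.
  rewrite -!mulmxA tens_mul vHH_ket -scalemxAr tens_mul mul1mx F_ev Kinv_ev.
  rewrite -[ev a.+1 in RHS]scale1r tensZ vHH_ket scalerA; congr (_ *: _).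
  by rewrite mul1r -vpowN -vpowD; congr vpow; rewrite /wtn -natr1; field.
have v2 : vHH p lam *m (Kmx *t F) = (1%:M *t F) *m vHH p lam.
  apply: ket_eq => a b ap bp.
  rewrite -!mulmxA tens_mul vHH_ket -scalemxAr tens_mul mul1mx F_ev K_ev.
  rewrite -[ev b.+1 in LHS]scale1r tensZ -scalemxAr vHH_ket scalerA; congr (_ *: _).
  by rewrite mulr1 -vpowD; congr vpow; rewrite /wtn -natr1; field.
have fl (A B : 'M[C]_p) : flip R p *m (A *t B) = (B *t A) *m flip R p.
  by apply: ket_eq => a b _ _; rewrite -!mulmxA tens_mul !flip_tens tens_mul.
rewrite /braiding /Rmx -/Theta -!mulmxA Theta_Delta_F [vHH p lam *m _]mulmxA mulmxDr.
rewrite v1 v2 -mulmxDl -[in LHS]mulmxA !mulmxA; congr (_ *m _ *m _).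
by rewrite mulmxDr !fl -mulmxDl /Delta_F.
Qed.

Lemma Delta_F_ket a b : Delta_F *m ket a b = (vpow p (wtn a))^-1 *: ket a b.+1 + ket a.+1 b.
Proof.
rewrite /Delta_F mulmxDl !tens_mul mul1mx !F_ev Kinv_ev -[ev b.+1 in LHS]scale1r.
by rewrite tensZ mulr1.
Qed.

Lemma FT_ev a : (a.+1 < p)%N -> F^T *m ev a.+1 = ev a.
Proof.
move=> ap; apply/matrixP => i j; rewrite !mxE (bigD1 (Ordinal ap)) //= !mxE /= eqxx.
rewrite mulr1 eqSS [a == i]eq_sym big1 ?addr0 // => k; rewrite -val_eqE /= => ka.
by rewrite !mxE (negbTE ka) mulr0.
Qed.

Lemma FT_ev0 : F^T *m ev 0 = 0.
Proof.
apply/matrixP => i j; rewrite !mxE big1 // => k _; rewrite !mxE.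
by case: eqP => [->|_]; rewrite ?mul0r ?mulr0.
Qed.

(** * Covectors, weights and the partial trace *)

Definition bra (u : 'cV[C]_(p * p)) a b : C := ((ket a b)^T *m u) 0 0.

Lemma braD u w a b : bra (u + w) a b = bra u a b + bra w a b.
Proof. by rewrite /bra mulmxDr mxE. Qed.

Lemma braZ x u a b : bra (x *: u) a b = x * bra u a b.
Proof. by rewrite /bra -scalemxAr mxE. Qed.

Lemma bra_sum n (u : 'I_n -> 'cV[C]_(p * p)) a b :
  bra (\sum_(i < n) u i) a b = \sum_(i < n) bra (u i) a b.
Proof. by rewrite /bra mulmx_sumr summxE. Qed.

(** Delta(F) read on covectors, where F^T lowers the indices. At b = 0 one summand disappears, which
    is why the covectors of v_k (x) v_0 form a single chain. *)
Lemma bra_Delta_F u a b : (a.+1 < p)%N -> (b < p)%N ->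
  bra (Delta_F *m u) a.+1 b
  = (if b is b'.+1 then (vpow p (wtn a.+1))^-1 * bra u a.+1 b' else 0) + bra u a b.
Proof.
move=> ap bp; rewrite /bra mulmxA -[(ket _ _)^T *m Delta_F]trmxK trmx_mul trmxK.
rewrite /Delta_F linearD /= !trmx_tens mulmxDl !tens_mul trmx1 mul1mx FT_ev //.
rewrite tr_diag_mx -/(Kinv) Kinv_ev linearD /= mulmxDl mxE; congr (_ + _).
case: b bp => [|b] bp.
  rewrite FT_ev0 -[tens _ _]/(tens (_ *: ev a.+1) 0).
  have -> : tens ((vpow p (wtn a.+1))^-1 *: ev a.+1) 0 = 0 :> 'cV[C]_(p * p).
    by apply: tens_ext => i j; rewrite tensE !mxE mulr0.
  by rewrite trmx0 mul0mx mxE.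
by rewrite FT_ev // -[ev b]scale1r tensZ mulr1 linearZ /= -scalemxAl mxE.
Qed.

(** The action of H up to an affine change. The integers a + b separate the weights, which the
    eigenvalues of K need not do at a root of unity. *)
Definition weightmx : 'M[C]_(p * p) :=
  diag_mx (\row_k ((mxtens_unindex k).1 + (mxtens_unindex k).2 : nat)%:R).

Lemma weight_ket a b : weightmx *m ket a b = (a + b)%:R *: ket a b.
Proof.
apply: tens_ext => i j; rewrite mul_diag_mx !mxE !mxtens_indexK /=.
by case: eqP => [->|_]; rewrite ?mul0r ?mulr0 //; case: eqP => [->|_]; rewrite ?mulr0.
Qed.

Lemma braiding_weight : c *m weightmx = weightmx *m c.
Proof.
apply: ket_eq => a b ap bp.
rewrite -[c *m _ *m _]mulmxA -[_ *m c *m _]mulmxA weight_ket -scalemxAr.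
rewrite braiding_ket //.
rewrite mulmx_sumr scaler_sumr; apply: eq_bigr => n _.
rewrite -scalemxAr weight_ket !scalerA.
have [an|na] := ltnP a n; first by rewrite En_coef_out // !(mulr0, mul0r).
by rewrite [X in _ = X *: _]mulrC; congr (_%:R * _ *: _); lia.
Qed.

(* Closing the second strand on the right. *)
Definition ptrace (X : 'M[C]_(p * p)) (i j : 'I_p) : C :=
  \sum_(b < p) pivot lam b * X (mxtens_index (i, b)) (mxtens_index (j, b)).

Lemma pivotE (b : 'I_p) : pivot lam b = vpow p ((1 - p%:R) * wtn b).
Proof.
rewrite /pivot -[wt lam b]/(wtn b).
have -> : 1 - p%:Z = - (p.-1)%:Z by lia.
rewrite -exprnN -vpowX -vpowN; congr vpow.
have -> : p%:R = p.-1%:R + 1 :> C by rewrite natr1 prednK.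
by ring.
Qed.

Lemma vpow_2p : vpow p (2%:R * p%:R) = 1 :> C.
Proof. by rewrite vpowX vpow_p // sqrrN expr1n. Qed.

(* The partial trace preserves weights and commutes with F, because X commutes with
   Delta F, so it is scalar; irreducibility of V_lambda is not needed. *)
Lemma ptrace_scalar X : X *m Delta_F = Delta_F *m X -> X *m weightmx = weightmx *m X ->
  forall i j k : 'I_p, ptrace X i j = ptrace X k k *+ (i == j).
Proof.
move=> hF hW.
have diag (i j : 'I_p) : i != j -> ptrace X i j = 0.
  move=> ij; rewrite /ptrace big1 // => b _; apply/eqP; rewrite mulf_eq0; apply/orP; right.
  have /matrixP /(_ (mxtens_index (i, b)) (mxtens_index (j, b))) := hW.
  rewrite mul_diag_mx mul_mx_diag !mxE !mxtens_indexK /= mulrC => /eqP.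
  rewrite -subr_eq0 -mulrBl mulf_eq0 subr_eq0 eqr_nat eqn_add2r.
  by case/orP => // /eqP /val_inj h; rewrite h eqxx in ij.
pose T a := \sum_(b < p) vpow p ((1 - p%:R) * wtn b) * bra (X *m ket a b) a b.
have TE (i : 'I_p) : ptrace X i i = T i.
  by apply: eq_bigr => b _; rewrite pivotE -entE.
have alg (x y z w t : C) : y + z = w + t -> x * z + x * y = x * t + x * w.
  by move=> h; rewrite -!mulrDr addrC h addrC.
have step a : (a.+1 < p)%N -> T a.+1 = T a.
  (* Entry (a+1, b) of X Delta(F) = Delta(F) X on v_a (x) v_b relates two diagonal entries of X and
     two off-diagonal ones. Weighted by the pivot, the latter are U b and U (b-1): the exponents
     agree up to 2p, and v^(2p) = 1. *)
  move=> ap; pose U b := vpow p ((1 - p%:R) * wtn b) * ((vpow p (wtn a))^-1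
    * bra (X *m ket a b.+1) a.+1 b).
  have e b : (b < p)%N -> vpow p ((1 - p%:R) * wtn b) * bra (X *m ket a.+1 b) a.+1 b
     + U b = vpow p ((1 - p%:R) * wtn b) * bra (X *m ket a b) a b
             + (if b is b'.+1 then U b' else 0).
    move=> bp; have := bra_Delta_F (X *m ket a b) ap bp.
    rewrite mulmxA -hF -mulmxA Delta_F_ket mulmxDr -scalemxAr braD braZ => h.
    apply: (etrans (alg _ _ _ _ _ h)); congr (_ + _).
    case: b {h} bp => [|b] bp; first by rewrite mulr0.
    rewrite /U !mulrA; congr (_ * _); rewrite -!vpowN -!vpowD.
    rewrite -[RHS]mulr1 -[X in _ = _ * X]vpow_2p -vpowD; congr vpow.
    rewrite /wtn -!natr1; ring.
  apply: (@telescope_sum _ _ (fun b => vpow p ((1 - p%:R) * wtn b)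
    * bra (X *m ket a.+1 b) a.+1 b) _ U e) => m pm.
  have k0 : ket a m.+1 = 0 by apply: ket_outr; rewrite pm.
  have b0 : bra (X *m ket a m.+1) a.+1 m = 0.
    by rewrite k0 mulmx0 /bra mulmx0 mxE.
  by rewrite /U b0 !mulr0.
have const := locally_constant step.
move=> i j k; have [->|ij] := eqVneq i j; last by rewrite diag.
by rewrite mulr1n !TE !const.
Qed.

(** * The full twist, its powers and the two closures *)

Lemma q_vpow n : q ^+ n = vpow p (2%:R * n%:R).
Proof. by rewrite -vpow2 mulr1 -vpowX mulrC. Qed.

Lemma R_coef0 : R_coef 0 = 1.
Proof. by rewrite /R_coef /brace_fact big_nil invr1 !mul0r vpow0 expr0 !mulr1. Qed.

Lemma braiding_ket0 k : c *m ket 0 k = vpow p (lam * wtn k / 2%:R) *: ket k 0.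
Proof.
rewrite braiding_ket // (bigD1 (Ordinal p_gt0)) //= big1 ?addr0 => [|n n0]; last first.
  by rewrite En_coef_out ?mulr0 ?mul0r ?scale0r // lt0n.
by rewrite R_coef0 /En_coef big_ord0 !mul1r addn0 subn0 /wtn mulr0 subr0.
Qed.

Lemma braiding_ket_last a : (a < p)%N ->
  c *m ket a p.-1 = vpow p (wtn a * wtn p.-1 / 2%:R) *: ket p.-1 a.
Proof.
move=> ap; rewrite braiding_ket // (bigD1 (Ordinal p_gt0)) //= big1 ?addr0 => [|n n0].
  by rewrite R_coef0 /En_coef big_ord0 !mul1r addn0 subn0.
have nn : (0 < n)%N by rewrite lt0n.
by rewrite ket_outl ?scaler0 //; lia.
Qed.

(** The q-binomial theorem: the summands K^-1 (x) F and F (x) 1 of Delta(F) q-commute, and each K^-1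
    acting on v_0 gives v^(-lam). *)
Lemma Delta_F_exp_ket m j : Delta_F ^+ m *m ket 0 j
  = \sum_(n < m.+1) (qbin q m n * vpow p (- ((m - n)%:R * lam))) *: ket n (j + (m - n))%N.
Proof.
elim: m => [|m IH].
  by rewrite expr0 mul1mx big_ord1 qbin0 subnn mul0r oppr0 vpow0 mulr1 scale1r addn0.
pose a n := q ^+ n * qbin q m n * vpow p (- ((m.+1 - n)%:R * lam)).
pose b n := qbin q m n * vpow p (- ((m - n)%:R * lam)).
transitivity (\sum_(n < m.+1) a n *: ket n (j + (m.+1 - n))%N
   + \sum_(n < m.+1) b n *: ket n.+1 (j + (m - n))%N).
  rewrite expmxS_mul.
  rewrite IH.
  rewrite mulmx_sumr.
  rewrite -[RHS]big_split.
  apply: eq_bigr => n _.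
  have nm : (n <= m)%N by rewrite -ltnS.
  rewrite -scalemxAr.
  rewrite Delta_F_ket.
  rewrite scalerDr.
  rewrite scalerA.
  apply: f_equal2; last by [].
  rewrite (subSn nm) addnS; apply: (congr1 (fun x => x *: _)).
  rewrite /a (subSn nm) q_vpow mulrAC -vpowN [RHS]mulrAC [RHS]mulrC -!mulrA -!vpowD.
  by congr (_ * vpow p _); rewrite /wtn -natr1; ring.
have -> : \sum_(n < m.+1) a n *: ket n (j + (m.+1 - n))%N
    = \sum_(n < m.+2) a n *: ket n (j + (m.+1 - n))%N.
  have am : a m.+1 = 0 by rewrite /a qbin_small // mulr0 mul0r.
  by rewrite [RHS]big_ord_recr /= am scale0r addr0.
rewrite big_ord_recl [RHS]big_ord_recl -addrA -big_split; congr (_ + _).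
  by rewrite /a [nat_of_ord ord0]/= expr0 !qbin0 !mul1r.
apply: eq_bigr => n _; rewrite /= (_ : bump 0 n = n.+1) //.
by rewrite /a /b !subSS -scalerDl -mulrDl -qbinSl.
Qed.

Lemma one_subq n : 1 - q ^+ n = - (vpow p n%:R * brace p (n%:R : C)).
Proof.
rewrite q_vpow /brace mulrBr -!vpowD subrr vpow0 opprB.
by congr (_ - vpow p _); ring.
Qed.

Lemma one_subz m : 1 - z * q ^+ m
  = vpow p (m%:R - lam) * brace p (lam - m%:R).
Proof.
rewrite q_vpow -vpowD /brace mulrBr -!vpowD.
have -> : m%:R - lam + (lam - m%:R) = 0 by ring.
by rewrite vpow0; congr (_ - vpow p _); ring.
Qed.

Lemma R_coef_rec n : (n.+1 < p)%N ->
  R_coef n.+1 * brace p n.+1%:R = R_coef n * (brace p 1 ^+ 2 * vpow p n%:R).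
Proof.
move=> np; have bn : brace p (n.+1%:R : C) != 0 by apply: brace_neq0.
have bf0 : brace_fact R p n != 0 by apply/brace_fact_neq0/ltnW.
rewrite /R_coef /brace_fact big_nat_recr //= -/(brace_fact R p n).
have -> : n.+1%:R * (n.+1%:R - 1) / 2%:R = n%:R * (n%:R - 1) / 2%:R + n%:R :> C.
  by rewrite -natr1; field.
rewrite vpowD mulnS exprD.
by field; rewrite bf0 bn.
Qed.

(** The coefficient of v_n (x) v_(k-n) in c^2 (v_0 (x) v_k), with braces rewritten as q-Pochhammer
    symbols. The induction compares consecutive terms after clearing the denominator 1 - q^(n+1),
    which is nonzero below p. *)
Lemma braiding_ket_coef k n : (n <= k < p)%N ->
  vpow p (lam * wtn k / 2%:R) * (R_coef n * En_coef k n * vpow p (wtn (k - n) * wtn n / 2%:R))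
  = vpow p (lam ^+ 2 - 2%:R * lam * k%:R + lam * n%:R)
    * (qbin q k n * qpoch (z * q ^+ (k - n)) q n).
Proof.
move=> /andP [nk kp]; elim: n nk => [|n IH] nk.
  rewrite R_coef0 /En_coef big_ord0 qbin0 qpoch0 !mul1r !mulr1 subn0 -vpowD.
  by congr vpow; rewrite /wtn; field.
have q1 : 1 - q ^+ n.+1 != 0.
  rewrite one_subq oppr_eq0 mulf_neq0 ?vpow_neq0 //.
  by apply: brace_neq0; exact: leq_ltn_trans nk kp.
apply: (mulIf q1).
pose s : C := lam - (k - n.+1)%:R.
have kn : (k - n = (k - n.+1).+1)%N by lia.
have en : (k - n)%:R = k%:R - n%:R :> C by rewrite natrB // ltnW.
have en1 : (k - n.+1)%:R = k%:R - n%:R - 1 :> C by rewrite natrB // -natr1; ring.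
transitivity (vpow p (lam * wtn k / 2%:R) * (R_coef n * En_coef k n
     * vpow p (wtn (k - n) * wtn n / 2%:R))
   * (vpow p lam * (1 - q ^+ (k - n)) * (1 - z * q ^+ (k - n.+1)))).
  rewrite one_subz !one_subq.
  have epsS : En_coef k n.+1 = En_coef k n * Ecoef (k - n) by rewrite /En_coef big_ord_recr.
  have b1 : brace p (1 : C) != 0 by apply: (@brace_neq0 _ _ 1%N); lia.
  have eE : Ecoef (k - n) = brace p (k - n)%:R * brace p (lam - (k - n.+1)%:R)
     / brace p 1 ^+ 2.
    have -> : lam - (k - n.+1)%:R = lam + 1 - (k - n)%:R by rewrite en1 en; ring.
    by rewrite /Ecoef; field.
  have w : vpow p (wtn (k - n.+1) * wtn n.+1 / 2%:R) * vpow p n.+1%:R * vpow p n%:R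
     = vpow p (wtn (k - n) * wtn n / 2%:R) * vpow p lam * vpow p (k - n)%:R
       * vpow p ((k - n.+1)%:R - lam).
    by rewrite -!vpowD; congr vpow; rewrite /wtn en1 en -natr1; field.
  have th : R_coef n.+1 * brace p n.+1%:R = R_coef n * (brace p 1 ^+ 2 * vpow p n%:R).
    by apply: R_coef_rec; exact: leq_ltn_trans nk kp.
  rewrite epsS eE.
  transitivity (- (vpow p (lam * wtn k / 2%:R) * En_coef k n * brace p (k - n)%:R
     * brace p (lam - (k - n.+1)%:R)
     * (vpow p (wtn (k - n.+1) * wtn n.+1 / 2%:R) * vpow p n.+1%:R) / brace p 1 ^+ 2
     * (R_coef n.+1 * brace p n.+1%:R))); first by ring.
  rewrite th; transitivity (- (vpow p (lam * wtn k / 2%:R) * En_coef k n * brace p (k - n)%:R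
     * brace p (lam - (k - n.+1)%:R) * R_coef n
     * (vpow p (wtn (k - n.+1) * wtn n.+1 / 2%:R) * vpow p n.+1%:R * vpow p n%:R))).
    by field.
  by rewrite w; ring.
rewrite IH; last exact: ltnW.
rewrite qpochS -[z * _ * q]mulrA -exprSr -kn.
have h := @qbin_step _ _ _ q_prim k n.
transitivity (vpow p (lam ^+ 2 - 2%:R * lam * k%:R + lam * n.+1%:R)
  * ((qbin q k n * (1 - q ^+ (k - n))) * ((1 - z * q ^+ (k - n.+1))
     * qpoch (z * q ^+ (k - n)) q n))).
  have -> : lam ^+ 2 - 2%:R * lam * k%:R + lam * n.+1%:R
     = lam ^+ 2 - 2%:R * lam * k%:R + lam * n%:R + lam by rewrite -natr1; ring.
  rewrite [vpow p (_ + lam)]vpowD; ring.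
by rewrite -h ?nk //; ring.
Qed.

Definition twist_coef k j : C := vpow p (lam ^+ 2 - lam * k%:R - lam * j%:R)
  * (qbin q k j * (z ^+ j * q ^+ (j * j.-1) * qpoch (z * q ^+ j) q (k - j))).

(* The full twist is triangular on the vectors Delta(F)^(k-j) (v_0 (x) v_j), with
   coefficients that do not change when Delta(F) is applied. *)
Lemma full_twist k : (k < p)%N ->
  c *m (c *m ket 0 k) = \sum_(j < k.+1) twist_coef k j *: (Delta_F ^+ (k - j) *m ket 0 j).
Proof.
move=> kp.
pose a n := R_coef n * En_coef k n * vpow p (wtn (k - n) * wtn n / 2%:R).
have -> : c *m (c *m ket 0 k)
    = \sum_(n < k.+1) (vpow p (lam * wtn k / 2%:R) * a n) *: ket n (k - n)%N.
  rewrite braiding_ket0 // -scalemxAr braiding_ket // scaler_sumr.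
  transitivity (\sum_(n < p) (vpow p (lam * wtn k / 2%:R) * a n) *: ket n (k - n)%N).
    by apply: eq_bigr => n _; rewrite scalerA.
  rewrite (big_ord_widen _
    (fun n => (vpow p (lam * wtn k / 2%:R) * a n) *: ket n (k - n)%N) kp).
  rewrite [RHS]big_mkcond; apply: eq_bigr => n _.
  by case: ltnP => // kn; rewrite /a En_coef_out // mulr0 mul0r mulr0 scale0r.
pose b j n := twist_coef k j * (qbin q (k - j) n * vpow p (- ((k - j - n)%:R * lam))).
transitivity (\sum_(j < k.+1) \sum_(n < k.+1) b j n *: ket n (k - n)%N); last first.
  apply: eq_bigr => j _; rewrite Delta_F_exp_ket // scaler_sumr.
  have jk : ((k - j).+1 <= k.+1)%N by rewrite ltnS leq_subr.
  transitivity (\sum_(n < (k - j).+1) b j n *: ket n (k - n)%N).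
    rewrite (big_ord_widen _ (fun n => b j n *: ket n (k - n)%N) jk).
    rewrite [RHS]big_mkcond; apply: eq_bigr => n _.
    by case: ltnP => // kn; rewrite /b qbin_small // mul0r mulr0 scale0r.
  apply: eq_bigr => n _; rewrite scalerA.
  have nk : (n <= k - j)%N by rewrite -ltnS.
  by have -> : (j + (k - j - n) = k - n)%N by have := leq_ord j; lia.
rewrite exchange_big; apply: eq_bigr => n _.
have nk : (n <= k)%N by rewrite -ltnS.
rewrite -scaler_suml; apply: (congr1 (fun x => x *: _)).
rewrite /a braiding_ket_coef ?nk // -(twist_sum q_prim) ?nk // mulr_sumr.
apply: eq_bigr => j _; rewrite /b /twist_coef.
have [kn|kn] := ltnP (k - j) n; first by rewrite (@qbin_small _ _ (k - j)) //; ring.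
have e : vpow p (lam ^+ 2 - 2%:R * lam * k%:R + lam * n%:R)
  = vpow p (lam ^+ 2 - lam * k%:R - lam * j%:R) * vpow p (- ((k - j - n)%:R * lam)).
  by rewrite -vpowD !natrB ?leq_ord //; congr vpow; ring.
by rewrite e; ring.
Qed.

Lemma Delta_F_exp_comm (X : 'M[C]_(p * p)) m (u : 'cV[C]_(p * p)) :
  X *m Delta_F = Delta_F *m X -> X *m (Delta_F ^+ m *m u) = Delta_F ^+ m *m (X *m u).
Proof.
move=> h; elim: m => [|m IH]; first by rewrite expr0 !mul1mx.
by rewrite expmxS_mul [LHS]mulmxA h -mulmxA IH expmxS_mul.
Qed.

Lemma exp_comm_mx (X Y : 'M[C]_(p * p)) m : X *m Y = Y *m X -> X ^+ m *m Y = Y *m X ^+ m.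
Proof. by move=> h; have := @commrX _ Y X m (esym h); rewrite /GRing.comm => /esym. Qed.

Lemma bra0_Delta_F_exp m k u : (m <= k < p)%N ->
  bra (Delta_F ^+ m *m u) k 0 = bra u (k - m)%N 0.
Proof.
elim: m k => [|m IH] k /andP [mk kp]; first by rewrite expr0 mul1mx subn0.
case: k mk kp => // k mk kp; rewrite expmxS_mul bra_Delta_F // add0r subSS IH //.
by apply/andP; split=> //; exact: ltnW.
Qed.

(* The covector of v_k (x) v_0 is mapped by Delta F to that of v_(k-1) (x) v_0, so the
   powers of the triangular matrix twist_coef give the entries directly. *)
Lemma twist_entry X t k : z = q * X -> (k < p)%N ->
  bra (c ^+ (2 * t) *m ket 0 k) k 0
  = vpow p (t%:R * lam ^+ 2 - lam * k%:R) * (qpoch z q k * bailey q X t k).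
Proof.
move=> zX; elim: t k => [|t IH] k kp.
  rewrite muln0 expr0 mul1mx [LHS]ket_dot // /bailey andbC eq_sym.
  case: k kp => [|k] _; last by rewrite /= !mulr0.
  by rewrite qpoch0 /= !mulr1 mulr0 mul0r subrr vpow0.
rewrite mulnS addnC addn2 !expmxSr_mul full_twist // mulmx_sumr.
have -> : bra (\sum_(j < k.+1)
     c ^+ (2 * t) *m (twist_coef k j *: (Delta_F ^+ (k - j) *m ket 0 j))) k 0
   = \sum_(j < k.+1) twist_coef k j * bra (c ^+ (2 * t) *m ket 0 j) j 0.
  rewrite bra_sum; apply: eq_bigr => j _.
  rewrite -scalemxAr braZ Delta_F_exp_comm; last first.
    by apply: exp_comm_mx; exact: braiding_Delta_F.
  have ks : (k - j <= k < p)%N by rewrite leq_subr.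
  by rewrite (bra0_Delta_F_exp _ ks) (subKn (leq_ord j)).
rewrite [bailey _ _ _ _]/= !mulr_sumr; apply: eq_bigr => j _.
have jk := leq_ord j.
rewrite IH; last exact: leq_ltn_trans jk kp.
have -> : qpoch z q k = qpoch z q j * qpoch (z * q ^+ j) q (k - j).
  by rewrite -qpochD subnKC.
(* Passing from j to k leaves a factor v^(-2 lam j) = z^j. Together with the z^j of [twist_coef],
   and as z = q X, it turns q^(j(j-1)) into q^(j(j+1)) X^(2j), the weight of the Bailey chain. *)
have e1 : vpow p (lam ^+ 2 - lam * k%:R - lam * j%:R) * vpow p (t%:R * lam ^+ 2 - lam * j%:R)
  = vpow p (t.+1%:R * lam ^+ 2 - lam * k%:R) * z ^+ j.
  by rewrite -vpowX -!vpowD; congr vpow; rewrite -natr1; ring.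
have e2 : z ^+ j * z ^+ j * q ^+ (j * j.-1) = q ^+ (j * (j + 1)) * X ^+ (2 * j).
  rewrite zX exprMn mulrACA -!exprD addnn -mul2n mulrAC -exprD; congr (q ^+ _ * _).
  by case: (j : nat) => [|i] //=; lia.
rewrite /twist_coef.
transitivity (vpow p (lam ^+ 2 - lam * k%:R - lam * j%:R)
  * vpow p (t%:R * lam ^+ 2 - lam * j%:R)
  * (qbin q k j * (z ^+ j * q ^+ (j * j.-1)) * qpoch (z * q ^+ j) q (k - j)
     * (qpoch z q j * bailey q X t j))); first by ring.
rewrite e1; transitivity (vpow p (t.+1%:R * lam ^+ 2 - lam * k%:R) *
  (qbin q k j * (z ^+ j * z ^+ j * q ^+ (j * j.-1)) * qpoch (z * q ^+ j) q (k - j)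
     * (qpoch z q j * bailey q X t j))); first by ring.
by rewrite e2; ring.
Qed.

(** After the flip the second factor of the covector is v_0, which F^T kills, so only the term n = 0
    of R survives. Thus the odd factor of c^(2t+1) leads to the entries of [twist_entry]. *)
Lemma bra0_braiding u b : bra (c *m u) 0 b = vpow p (lam * wtn b / 2%:R) * bra u b 0.
Proof.
have cT : c^T *m ket 0 b = vpow p (lam * wtn b / 2%:R) *: ket b 0.
  have flipT : (flip R p)^T = flip R p.
    apply/matrixP => k l; rewrite !mxE /= andbC.
    by congr ((_ && _)%:R); exact: eq_sym.
  have -> : c = flip R p *m (vHH p lam *m Theta) by [].
  rewrite trmx_mul flipT -mulmxA flip_tens.
  rewrite trmx_mul tr_diag_mx -/(vHH p lam) -mulmxA vHH_ket -scalemxAr.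
  have -> : wtn b * wtn 0 / 2%:R = lam * wtn b / 2%:R by rewrite /wtn; ring.
  apply: (congr1 (fun w => _ *: w)).
  rewrite /Theta linear_sum /= mulmx_suml (bigD1 (Ordinal p_gt0)) //= big1 ?addr0.
    rewrite linearZ /= !expr0 R_coef0 scale1r trmx_tens !trmx1.
    by rewrite tens_mul !mul1mx.
  move=> [[|n] np] // _; rewrite linearZ /= trmx_tens -scalemxAl tens_mul.
  rewrite [F ^+ _]exprS -mulmxE trmx_mul -mulmxA FT_ev0 mulmx0.
  by rewrite (_ : tens _ 0 = 0) ?scaler0 //; apply: tens_ext => i j; rewrite tensE !mxE mulr0.
have <- : bra (vpow p (lam * wtn b / 2%:R) *: u) b 0 = vpow p (lam * wtn b / 2%:R) * bra u b 0.
  exact: braZ.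
have E a d w : bra w a d = ((ket a d)^T *m w) 0 0 by [].
rewrite !E mulmxA -[(ket 0 b)^T *m c]trmxK trmx_mul trmxK cT.
by rewrite linearZ /= -scalemxAl -scalemxAr.
Qed.

Lemma vpow_period k : vpow p (2%:R * p%:R * k%:R) = 1 :> C.
Proof. by rewrite mulrC vpowX vpow_2p // expr1n. Qed.

Lemma ptrace_torus t (i j : 'I_p) :
  ptrace (c ^+ (2 * t + 1)) i j
  = vpow p ((1 - p%:R) * lam + lam ^+ 2 / 2%:R + t%:R * lam ^+ 2)
    * torus_poly q p x^-1 t *+ (i == j).
Proof.
rewrite (@ptrace_scalar _ _ _ i j (Ordinal p_gt0)); last 2 first.
- by apply: exp_comm_mx; exact: braiding_Delta_F.
- by apply: exp_comm_mx; exact: braiding_weight.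
have xE : x^-1 = vpow p (- (2%:R * (lam + 1))) by rewrite -vpow2 vpowN.
have zX : z = q * x^-1 by rewrite xE -[q]vpow2 -vpowD; congr vpow; ring.
apply: (congr1 (fun y => y *+ (i == j))).
rewrite /ptrace /torus_poly mulr_sumr; apply: eq_bigr => b _.
rewrite pivotE // -entE.
have -> : ent (c ^+ (2 * t + 1)) (Ordinal p_gt0) b (Ordinal p_gt0) b
  = bra (c *m (c ^+ (2 * t) *m ket 0 b)) 0 b by rewrite addn1 -expmxS_mul.
rewrite bra0_braiding (twist_entry _ zX) // -zX.
(* In b, the pivot contributes v^(-2b) up to v^(2pb) = 1, and the braidings v^(-2 lam b); together
   this is x^(-b), the origin of 1/x. *)
have e : vpow p ((1 - p%:R) * wtn b) * (vpow p (lam * wtn b / 2%:R)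
    * vpow p (t%:R * lam ^+ 2 - lam * b%:R))
  = vpow p ((1 - p%:R) * lam + lam ^+ 2 / 2%:R + t%:R * lam ^+ 2) * x^-1 ^+ b.
  rewrite -[RHS]mulr1 -[X in _ = _ * X](vpow_period b) xE -vpowX -!vpowD.
  by congr vpow; rewrite /wtn; field.
transitivity (vpow p ((1 - p%:R) * wtn b) * (vpow p (lam * wtn b / 2%:R)
    * vpow p (t%:R * lam ^+ 2 - lam * b%:R)) * (qpoch z q b * bailey q x^-1 t b)).
  by ring.
by rewrite e; ring.
Qed.

(* The inverse braiding is monomial on v_(p-1) (x) v_b, so the scalar of the negative
   kink is read off at the lowest weight vector. *)
Definition kink : C := vpow p ((1 - p%:R) * wtn p.-1 - wtn p.-1 ^+ 2 / 2%:R).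

Lemma ptrace_kink (i j : 'I_p) : ptrace (invmx c) i j = kink *+ (i == j).
Proof.
have cu := braiding_unit lam p_gt0.
have inv_comm (Y : 'M[C]_(p * p)) : c *m Y = Y *m c -> invmx c *m Y = Y *m invmx c.
  by move=> h; apply: (can_inj (mulKmx cu)); rewrite mulKVmx // mulmxA h mulmxK.
have pl : (p.-1 < p)%N by rewrite prednK.
rewrite (@ptrace_scalar _ _ _ i j (Ordinal pl)); last 2 first.
- by apply: inv_comm; exact: braiding_Delta_F.
- by apply: inv_comm; exact: braiding_weight.
apply: (congr1 (fun y => y *+ (i == j))).
have e (b : 'I_p) : invmx c (mxtens_index (Ordinal pl, b)) (mxtens_index (Ordinal pl, b))
   = (Ordinal pl == b)%:R * vpow p (- (wtn b * wtn p.-1 / 2%:R)).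
  rewrite -entE.
  have -> : ent (invmx c) (Ordinal pl) b (Ordinal pl) b = bra (invmx c *m ket p.-1 b) p.-1 b.
    by [].
  have -> : invmx c *m ket p.-1 b = vpow p (- (wtn b * wtn p.-1 / 2%:R)) *: ket b p.-1.
    have h := braiding_ket_last (ltn_ord b).
    have -> : ket b p.-1 = invmx c *m (c *m ket b p.-1) by rewrite mulmxA mulVmx // mul1mx.
    by rewrite h -scalemxAr scalerA vpowN mulVf ?vpow_neq0 // scale1r.
  rewrite braZ mulrC; apply: (congr1 (fun y => y * _)).
  rewrite [LHS]ket_dot // -val_eqE /= [(b : nat) == p.-1]eq_sym; by case: eqP.
rewrite /ptrace; under eq_bigr => b _ do rewrite e mulrCA.
rewrite (@big_delta _ _ (Ordinal pl)
  (fun b : 'I_p => pivot lam b * vpow p (- (wtn b * wtn p.-1 / 2%:R)))) pivotE //.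
by rewrite -vpowD; congr vpow; rewrite expr2.
Qed.

Lemma RT_torus t (i j : 'I_p) :
  RT lam (torus_tangle t) [:: i] [:: j]
  = q ^+ t * x ^+ (t * p.-1) * torus_poly q p x^-1 t *+ (i == j).
Proof.
pose sc := vpow p ((1 - p%:R) * lam + lam ^+ 2 / 2%:R + t%:R * lam ^+ 2)
    * torus_poly q p x^-1 t.
pose f (k : seq 'I_p) : C := RT lam (right_closure (tpow tpos (2 * t + 1))) [:: i] k
  * RT lam (tpow (right_closure tneg) (2 * t + 1)) k [:: j].
transitivity (\sum_(k : 1.-tuple 'I_p) f k); first by [].
rewrite big_tuple_cons.
transitivity (\sum_a (i == a)%:R * (sc * (kink ^+ (2 * t + 1) *+ (a == j)))).
  apply: eq_bigr => a _; rewrite (@big_tuple0 _ _ (fun k => f (a :: k))) /f.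
  rewrite (@RT_tpow_scalar _ _ _ _ kink); last first.
    move=> k l; rewrite RT_right_closure -ptrace_kink; apply: eq_bigr => b _.
    by [].
  have -> : RT lam (right_closure (tpow tpos (2 * t + 1))) [:: i] [:: a] = sc *+ (i == a).
    rewrite RT_right_closure -ptrace_torus; apply: eq_bigr => b _.
    by rewrite RT_tpow_pos.
  by rewrite -[sc *+ _]mulr_natr; ring.
rewrite big_delta mulrnAr; apply: (congr1 (fun y => y *+ (i == j))).
rewrite /sc mulrAC; apply: (congr1 (fun y => y * _)).
have -> : q ^+ t * x ^+ (t * p.-1)
    = vpow p (2%:R * t%:R + (t * p.-1)%:R * (2%:R * (lam + 1))).
  by rewrite q_vpow -[x]vpow2 -vpowX -vpowD.
(* The 2t + 1 kinks cancel the lam^2 terms of the positive closure; what is left is q^t x^(t(p-1)),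
   up to v^(2pt) = 1. *)
rewrite /kink -vpowX -vpowD -[LHS]mulr1 -[X in _ * X = _](vpow_period t) -vpowD.
apply: (congr1 (vpow p)).
have e : p.-1%:R = p%:R - 1 :> C by rewrite -[in RHS](prednK p_gt0) -natr1; ring.
rewrite !(natrM, natrD) /wtn e.
by field.
Qed.
End Representation.

Theorem theorem2p6 (R : realType) (t p : nat) (ht : (1 <= t)%N) (hp : (1 <= p)%N)
    (A : {fraction {poly R[i]}}) :
  is_ADO p (torus_tangle t) A <-> A = torus_formula R t p.
Proof.
suff h : is_ADO p (torus_tangle t) (torus_formula R t p).
  by split=> [hA|->//]; exact: is_ADO_unique hp hA h.
split; first exact: writhe_torus.
have [P [n [fE PE]]] := torus_formula_poly R ht hp.
case: eqP => [p1|_]; first exact: torus_formula1.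
exists P, n; split=> // lam _ x.
apply/matrixP => i j; rewrite !mxE RT_torus // PE //.
by rewrite /x -vpow2 vpow_neq0.
Qed.
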